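(* Let $(M,g)$ be an oriented Riemannian $4$-manifold and $p\in M$. The $Q$-self-adjoint map $\hat R_\wedge:\Lambda^2(T_pM)\to\Lambda^2(T_pM)$ commutes with the Hodge star $*_h$ of some Riemannian metric (inner product) $h$ on $T_pM$ if and only if $\hat R_\wedge$ is real-diagonalizable, i.e. diagonalizable as an endomorphism of the real vector space $\Lambda^2(T_pM)$.
   Context: For an inner product $k$ on the oriented $4$-dimensional space $T_pM$, $\Lambda^2(T_pM)$ carries the inner product $\langle v\wedge w,x\wedge y\rangle_k=k(v,x)k(w,y)-k(v,y)k(w,x)$. With $dV_k\in\Lambda^4(T_pM)$ the positively oriented $k$-unit element, the Hodge star $*_k$ on $\Lambda^2(T_pM)$ is defined by $\xi\wedge *_k\eta=\langle\xi,\eta\rangle_k\,dV_k$. $Q$ is the wedge pairing on $\Lambda^2(T_pM)$, $Q(\xi,\eta)\,dV_g:=\xi\wedge\eta$ (a symmetric bilinear form of signature $(3,3)$). The curvature tensor of $g$ is $\mathrm{Rm}_g(v,w,x,y)=g(\nabla_v\nabla_w x-\nabla_w\nabla_v x-\nabla_{[v,w]}x,\,y)$, viewed as a symmetric bilinear form on $\Lambda^2(T_pM)$ via $\mathrm{Rm}_g(v\wedge w,x\wedge y)=\mathrm{Rm}_g(v,w,x,y)$. The $Q$-self-adjoint endomorphism $\hat R_\wedge$ is defined by $Q(\hat R_\wedge(\xi),\eta):=\mathrm{Rm}_g(\xi,\eta)$ for all $\xi,\eta\in\Lambda^2(T_pM)$. *)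

(* Defs.v *)
From mathcomp Require Import all_boot all_order all_algebra.
From mathcomp Require Import all_classical all_reals all_analysis.
From mathcomp Require Import ring.

Set Implicit Arguments.
Unset Strict Implicit.
Unset Printing Implicit Defensive.

Import Order.TTheory GRing.Theory Num.Theory.
Import numFieldNormedType.Exports.

Local Open Scope classical_set_scope.
Local Open Scope ring_scope.

Section Smooth.
Context {R : realType}.
Local Notation E := 'rV[R]_4.

Definition ebase (i : 'I_4) : E := delta_mx 0 i.

Definition partial (i : 'I_4) (f : E -> R) : E -> R :=
  fun x => 'D_(ebase i) f x.

Definition iter_partial (s : seq 'I_4) (f : E -> R) : E -> R :=
  foldr partial f s.

(* C^oo, for U open: all iterated partial derivatives, in any order, exist and
   are continuous at every point of U. *)
Definition smooth_on (U : set E) (f : E -> R) : Prop :=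
  forall (s : seq 'I_4) (x : E), U x ->
    {for x, continuous (iter_partial s f)} /\
    (forall i : 'I_4, derivable (iter_partial s f) x (ebase i)).

End Smooth.

Section InnerProduct.
Context {R : realType}.
Local Notation E := 'rV[R]_4.

(* Bilinear form with Gram matrix [k]; vectors are rows of coordinates. *)
Definition gram_form n (k : 'M[R]_n) (v w : 'rV[R]_n) : R :=
  (v *m k *m w^T) 0 0.

Definition inner_product (k : 'M[R]_4) : Prop :=
  (forall v w : E, gram_form k v w = gram_form k w v) /\
  (forall v : E, v != 0 -> 0 < gram_form k v v).

End InnerProduct.

Section Manifold.
Variable R : realType.
Local Notation E := 'rV[R]_4.

(* [cmap] and [cinv] only matter on [cdom] and [cimg] respectively. *)
Record chart (M : topologicalType) := Chart {
  cdom : set M;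
  cimg : set E;
  cmap : M -> E;
  cinv : E -> M;
  cdom_open : open cdom;
  cimg_open : open cimg;
  cmap_img : forall p, cdom p -> cimg (cmap p);
  cinv_dom : forall x, cimg x -> cdom (cinv x);
  cmapK : forall p, cdom p -> cinv (cmap p) = p;
  cinvK : forall x, cimg x -> cmap (cinv x) = x;
  cmap_cont : {within cdom, continuous cmap};
  cinv_cont : {within cimg, continuous cinv}
}.

Definition overlap (M : topologicalType) (c d : chart M) : set E :=
  [set x | cimg c x /\ cdom d (cinv c x)].

Definition transition (M : topologicalType) (c d : chart M) : E -> E :=
  fun x => cmap d (cinv c x).

(* The orientation is the one for which all charts of the atlas are positively
   oriented. *)
Record oriented_manifold4 := OrientedManifold4 {
  carrier :> topologicalType;
  carrier_hausdorff : hausdorff_space carrier;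
  carrier_second_countable : @second_countable carrier;
  atlas : set (chart carrier);
  atlas_cover : forall p : carrier, exists2 c, atlas c & cdom c p;
  atlas_smooth : forall c d, atlas c -> atlas d ->
    forall i : 'I_4,
      smooth_on (overlap c d) (fun x => transition c d x 0 i);
  atlas_oriented : forall c d, atlas c -> atlas d ->
    forall x, overlap c d x -> 0 < \det ('J (transition c d) x)
}.

(* [gcoef c x] is the Gram matrix of the metric at [cinv c x] in the coordinate
   basis of the chart [c].  As ['J] acts on row vectors from the right, the
   components v of a tangent vector in [c] become v *m 'J in [d]. *)
Record riemannian_metric (M : oriented_manifold4) := RiemannianMetric {
  gcoef : chart M -> E -> 'M[R]_4;
  gcoef_smooth : forall c, atlas c ->
    forall i j : 'I_4, smooth_on (cimg c) (fun x => gcoef c x i j);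
  gcoef_inner : forall c, atlas c ->
    forall x, cimg c x -> inner_product (gcoef c x);
  gcoef_transform : forall c d, atlas c -> atlas d ->
    forall x, overlap c d x ->
      gcoef c x = 'J (transition c d) x *m gcoef d (transition c d x)
                    *m ('J (transition c d) x)^T
}.

End Manifold.

Section Curvature.
Context {R : realType}.
Local Notation E := 'rV[R]_4.
Variable g : E -> 'M[R]_4.

(* Gamma^k_{ij}; [g y] is the Gram matrix of the metric at the point of
   coordinates y. *)
Definition christoffel (k i j : 'I_4) (x : E) : R :=
  2^-1 * \sum_(l < 4) invmx (g x) k l *
    (partial i (fun y => g y j l) x + partial j (fun y => g y i l) x
     - partial l (fun y => g y i j) x).

(* nabla_V X for the Levi-Civita connection of g, where V and X are vector fields
   given by their components in the chart. *)
Definition covariant (V X : E -> E) : E -> E := fun x =>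
  'D_(V x) X x
  + \row_k \sum_(i < 4) \sum_(j < 4) christoffel k i j x * V x 0 i * X x 0 j.

Definition lie_bracket (V W : E -> E) : E -> E := fun x =>
  'D_(V x) W x - 'D_(W x) V x.

Definition riem_fields (V W X Y : E -> E) (x : E) : R :=
  gram_form (g x)
    (covariant V (covariant W X) x - covariant W (covariant V X) x
     - covariant (lie_bracket V W) X x)
    (Y x).

(* Tangent vectors at [x] are extended to fields with constant components; the
   value does not depend on the extension since curvature is tensorial. *)
Definition riem (x : E) (v w a b : E) : R :=
  riem_fields (fun=> v) (fun=> w) (fun=> a) (fun=> b) x.

End Curvature.

Section Bivectors.
Context {R : realType}.
Local Notation E := 'rV[R]_4.
(* Lambda^2 of the span of e_0, .., e_3, with basis e_i /\ e_j (i < j) in the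
   order listed by [bidx]. *)
Local Notation L2 := 'rV[R]_6.

Definition bidx (a : 'I_6) : 'I_4 * 'I_4 :=
  tnth [tuple (0, 1); (0, 2); (0, 3); (1, 2); (1, 3); (2, 3)] a.

Definition wedge (v w : E) : L2 :=
  \row_a (v 0 (bidx a).1 * w 0 (bidx a).2 - v 0 (bidx a).2 * w 0 (bidx a).1).

(* Gram matrix of the bilinear form on Lambda^2 with
   (v /\ w, x /\ y) |-> B v w x y. *)
Definition lam2_form (B : E -> E -> E -> E -> R) : 'M[R]_6 :=
  \matrix_(a, b) B (ebase (bidx a).1) (ebase (bidx a).2)
                   (ebase (bidx b).1) (ebase (bidx b).2).

(* v /\ w /\ x /\ y = vol4 v w x y * (e_0 /\ e_1 /\ e_2 /\ e_3) *)
Definition vol4 (v w x y : E) : R :=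
  \det (\matrix_(i < 4) tnth [tuple v; w; x; y] i).

(* Elements of Lambda^4 are identified with their coefficient on
   e_0 /\ e_1 /\ e_2 /\ e_3; the latter is assumed positively oriented. *)
Definition wedge22 (xi eta : L2) : R := gram_form (lam2_form vol4) xi eta.

Definition lam2_inner (k : 'M[R]_4) : 'M[R]_6 :=
  lam2_form (fun v w x y => gram_form k v x * gram_form k w y
                            - gram_form k v y * gram_form k w x).

(* The positive k-unit element of Lambda^4, as a multiple of
   e_0 /\ e_1 /\ e_2 /\ e_3, whose squared k-length is \det k. *)
Definition dvol (k : 'M[R]_4) : R := (Num.sqrt (\det k))^-1.

(* Endomorphisms of Lambda^2 act on row vectors: xi |-> xi *m A.
   See [hodgeP], [wedge_pairingE] and [curv_opP] for the defining identities of
   the next three notions. *)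
Definition hodge (k : 'M[R]_4) : 'M[R]_6 :=
  dvol k *: ((lam2_inner k)^T *m (invmx (lam2_form vol4))^T).

Definition wedge_pairing (k : 'M[R]_4) : 'M[R]_6 :=
  (dvol k)^-1 *: lam2_form vol4.

Definition curv_op (g : E -> 'M[R]_4) (x : E) : 'M[R]_6 :=
  lam2_form (riem g x) *m invmx (wedge_pairing (g x)).

Lemma ebase_sum (v : E) : v = \sum_i v 0 i *: ebase i.
Proof. exact: row_sum_delta. Qed.

Lemma alt2_wedge (f : E -> E -> R) :
  (forall w a v v', f (a *: v + v') w = a * f v w + f v' w) ->
  (forall v a w w', f v (a *: w + w') = a * f v w + f v w') ->
  (forall v, f v v = 0) ->
  forall v w, f v w =
    \sum_a wedge v w 0 a * f (ebase (bidx a).1) (ebase (bidx a).2).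
Proof.
move=> fl fr fa v w.
have f0l u : f 0 u = 0.
  have := fl u 1 0 0; rewrite scale1r add0r mul1r => /eqP.
  by rewrite -subr_eq0 opprD addrA subrr sub0r oppr_eq0 => /eqP.
have f0r u : f u 0 = 0.
  have := fr u 1 0 0; rewrite scale1r add0r mul1r => /eqP.
  by rewrite -subr_eq0 opprD addrA subrr sub0r oppr_eq0 => /eqP.
have fsym u u' : f u u' = - f u' u.
  apply/eqP; rewrite -addr_eq0; apply/eqP.
  have := fa (1 *: u + u').
  by rewrite fl !fr !fa !mul1r add0r addr0.
have fsl (F : 'I_4 -> R) u :
    f (\sum_i F i *: ebase i) u = \sum_i F i * f (ebase i) u.
  apply: (big_ind2 (fun X Y => f X u = Y)) => // [x1 x2 y1 y2 <- <-|i _].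
    by have := fl u 1 x1 y1; rewrite scale1r mul1r.
  by rewrite -[X in f X]addr0 fl f0l addr0.
have fsr (F : 'I_4 -> R) u :
    f u (\sum_i F i *: ebase i) = \sum_i F i * f u (ebase i).
  apply: (big_ind2 (fun X Y => f u X = Y)) => // [x1 x2 y1 y2 <- <-|i _].
    by have := fr u 1 x1 y1; rewrite scale1r mul1r.
  by rewrite -[X in f u X]addr0 fr f0r addr0.
rewrite {1}(ebase_sum v) {1}(ebase_sum w) fsl.
under eq_bigr do rewrite fsr.
rewrite !big_ord_recl !big_ord0 /= !mxE /bidx !(tnth_nth (0, 0)) /=.
have -> : lift ord0 ord0 = 1 :> 'I_4 by apply/val_inj.
have -> : lift ord0 (lift ord0 ord0) = 2 :> 'I_4 by apply/val_inj.
have -> : lift ord0 (lift ord0 (lift ord0 ord0)) = 3 :> 'I_4 by apply/val_inj.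
have -> : ord0 = 0 :> 'I_4 by apply/val_inj.
rewrite !fa (fsym (ebase 1) (ebase 0)) (fsym (ebase 2) (ebase 0)).
rewrite (fsym (ebase 3) (ebase 0)) (fsym (ebase 2) (ebase 1)).
rewrite (fsym (ebase 3) (ebase 1)) (fsym (ebase 3) (ebase 2)).
by ring.
Qed.

Lemma gram_formE n (k : 'M[R]_n) v w :
  gram_form k v w = \sum_a v 0 a * \sum_b k a b * w 0 b.
Proof.
rewrite /gram_form -mulmxA mxE; apply: eq_bigr => a _; congr (_ * _).
by rewrite mxE; apply: eq_bigr => b _; rewrite mxE.
Qed.

Lemma lam2_formE (B : E -> E -> E -> E -> R) :
  (forall w x y a v v', B (a *: v + v') w x y = a * B v w x y + B v' w x y) ->
  (forall v x y a w w', B v (a *: w + w') x y = a * B v w x y + B v w' x y) ->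
  (forall v w y a x x', B v w (a *: x + x') y = a * B v w x y + B v w x' y) ->
  (forall v w x a y y', B v w x (a *: y + y') = a * B v w x y + B v w x y') ->
  (forall v x y, B v v x y = 0) ->
  (forall v w x, B v w x x = 0) ->
  forall v w x y,
    gram_form (lam2_form B) (wedge v w) (wedge x y) = B v w x y.
Proof.
move=> B1 B2 B3 B4 Ba Bb v w x y; rewrite gram_formE.
rewrite (@alt2_wedge (fun v w => B v w x y)) //.
apply: eq_bigr => a _; congr (_ * _).
rewrite (@alt2_wedge (B _ _)) //; apply: eq_bigr => b _.
by rewrite mxE mulrC.
Qed.

Lemma gram_form_linl n (k : 'M[R]_n) a u u' v :
  gram_form k (a *: u + u') v = a * gram_form k u v + gram_form k u' v.
Proof. by rewrite /gram_form !mulmxDl -!scalemxAl !mxE. Qed.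

Lemma gram_form_linr n (k : 'M[R]_n) a u u' v :
  gram_form k v (a *: u + u') = a * gram_form k v u + gram_form k v u'.
Proof. by rewrite /gram_form linearP /= !mulmxDr -!scalemxAr !mxE. Qed.

Lemma lam2_innerE (k : 'M[R]_4) v w x y :
  gram_form (lam2_inner k) (wedge v w) (wedge x y) =
  gram_form k v x * gram_form k w y - gram_form k v y * gram_form k w x.
Proof.
by rewrite lam2_formE // => *; rewrite ?gram_form_linl ?gram_form_linr; ring.
Qed.

Lemma det_nat_row n (F : nat -> nat -> R) :
  \det (\matrix_(i < n.+1, j < n.+1) F i j) =
  \sum_(k < n.+1) F 0%N k *
    ((-1) ^+ k * \det (\matrix_(i < n, j < n) F i.+1 (bump k j))).
Proof.
rewrite (expand_det_row _ ord0); apply: eq_bigr => k _.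
rewrite mxE /cofactor /= add0n; congr (_ * (_ * \det _)).
by apply/matrixP => i j; rewrite !mxE.
Qed.

Lemma vol4E (v w x y : E) : vol4 v w x y =
  (v 0 0 * w 0 1 - v 0 1 * w 0 0) * (x 0 2 * y 0 3 - x 0 3 * y 0 2)
  - (v 0 0 * w 0 2 - v 0 2 * w 0 0) * (x 0 1 * y 0 3 - x 0 3 * y 0 1)
  + (v 0 0 * w 0 3 - v 0 3 * w 0 0) * (x 0 1 * y 0 2 - x 0 2 * y 0 1)
  + (v 0 1 * w 0 2 - v 0 2 * w 0 1) * (x 0 0 * y 0 3 - x 0 3 * y 0 0)
  - (v 0 1 * w 0 3 - v 0 3 * w 0 1) * (x 0 0 * y 0 2 - x 0 2 * y 0 0)
  + (v 0 2 * w 0 3 - v 0 3 * w 0 2) * (x 0 0 * y 0 1 - x 0 1 * y 0 0).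
Proof.
rewrite /vol4.
pose N (u : E) (k : nat) := u 0 (inord k).
have NE (u : E) (i : 'I_4) : u 0 i = N u i by rewrite /N inord_val.
pose F (i k : nat) := N (nth 0 [:: v; w; x; y] i) k.
have -> : \matrix_(i < 4) tnth [tuple v; w; x; y] i =
          \matrix_(i < 4, j < 4) F i j.
  by apply/matrixP => i j; rewrite !mxE (tnth_nth 0) NE.
have D1 (G : nat -> nat -> R) :
    \det (\matrix_(i < 1, j < 1) G i j) = G 0%N 0%N.
  by rewrite det_mx11 mxE.
have D2 (G : nat -> nat -> R) : \det (\matrix_(i < 2, j < 2) G i j) =
    G 0%N 0%N * G 1%N 1%N - G 0%N 1%N * G 1%N 0%N.
  rewrite det_nat_row !big_ord_recl big_ord0.
  rewrite !(D1 (fun i j => G i.+1 (bump _ j))) /=.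
  by rewrite /bump /=; ring.
have D3 (G : nat -> nat -> R) : \det (\matrix_(i < 3, j < 3) G i j) =
    G 0%N 0%N * (G 1%N 1%N * G 2%N 2%N - G 1%N 2%N * G 2%N 1%N)
    - G 0%N 1%N * (G 1%N 0%N * G 2%N 2%N - G 1%N 2%N * G 2%N 0%N)
    + G 0%N 2%N * (G 1%N 0%N * G 2%N 1%N - G 1%N 1%N * G 2%N 0%N).
  rewrite det_nat_row !big_ord_recl big_ord0.
  rewrite !(D2 (fun i j => G i.+1 (bump _ j))) /=.
  by rewrite /bump /=; ring.
rewrite det_nat_row !big_ord_recl big_ord0.
rewrite !(D3 (fun i j => F i.+1 (bump _ j))) !NE {NE} /F /= /bump /= {F}.
move: (N v) (N w) (N x) (N y) => {}v {}w {}x {}y.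
by ring.
Qed.

Lemma vol4_gramE a b : lam2_form vol4 a b =
  ((a + b == 5)%N)%:R * (-1) ^+ ((a == 1 :> nat) || (b == 1 :> nat)) :> R.
Proof.
have W (c d : 'I_6) :
    wedge (ebase (bidx c).1) (ebase (bidx c).2) 0 d = (d == c)%:R :> R.
  rewrite /wedge /ebase !mxE /= /bidx !(tnth_nth (0, 0)).
  case: c => [[|[|[|[|[|[|//]]]]]] ?]; case: d => [[|[|[|[|[|[|//]]]]]] ?] /=;
    by rewrite !(mul0r, mulr0, mul1r, subr0).
have V (v w x y : E) : vol4 v w x y =
    \sum_(c < 6) (-1) ^+ ((c == 1 :> nat) || (c == 4 :> nat))
      * (wedge v w 0 c * wedge x y 0 (rev_ord c)).
  rewrite vol4E !big_ord_recl big_ord0 !mxE /bidx !(tnth_nth (0, 0)) /=.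
  by ring.
rewrite mxE V (bigD1 a) //= big1 => [|c /negPf nca]; last first.
  by rewrite !W nca mul0r mulr0.
rewrite !W eqxx mul1r addr0.
by case: a => [[|[|[|[|[|[|//]]]]]] ?]; case: b => [[|[|[|[|[|[|//]]]]]] ?] /=;
  rewrite !(mul0r, mulr0, mul1r, mulr1).
Qed.

Lemma vol4_gramV : lam2_form vol4 *m lam2_form vol4 = 1%:M :> 'M[R]_6.
Proof.
apply/matrixP => a b; rewrite !mxE.
under eq_bigr do rewrite !vol4_gramE.
rewrite !big_ord_recl big_ord0.
have -> : (a == b) = (nat_of_ord a == b) by [].
case: a => [[|[|[|[|[|[|//]]]]]] ?]; case: b => [[|[|[|[|[|[|//]]]]]] ?] /=;
  rewrite ?expr0 ?expr1; by ring.
Qed.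

Lemma vol4_unit : (lam2_form vol4 : 'M[R]_6) \in unitmx.
Proof. by case/mulmx1_unit: vol4_gramV. Qed.

Lemma vol4_gram_sym : (lam2_form vol4)^T = lam2_form vol4 :> 'M[R]_6.
Proof.
by apply/matrixP => a b; rewrite mxE !vol4_gramE addnC orbC.
Qed.

Lemma gram_form_inj n (k k' : 'M[R]_n) :
  (forall xi eta, gram_form k xi eta = gram_form k' xi eta) -> k = k'.
Proof.
move=> H; apply/matrixP => a b.
have ent (m : 'M[R]_n) : gram_form m (delta_mx 0 a) (delta_mx 0 b) = m a b.
  by rewrite /gram_form -rowE trmx_delta -colE !mxE.
by rewrite -!ent H.
Qed.

Lemma hodgeP (k : 'M[R]_4) (A : 'M[R]_6) :
  A = hodge k <->
  forall xi eta : L2,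
    wedge22 xi (eta *m A) = gram_form (lam2_inner k) xi eta * dvol k.
Proof.
have E1 xi eta : wedge22 xi (eta *m A) =
    gram_form (lam2_form vol4 *m A^T) xi eta.
  by rewrite /wedge22 /gram_form trmx_mul !mulmxA.
have E2 xi eta : gram_form (lam2_inner k) xi eta * dvol k =
    gram_form (dvol k *: lam2_inner k) xi eta.
  by rewrite /gram_form -scalemxAr -scalemxAl [RHS]mxE mulrC.
have E3 : (A = hodge k) <-> lam2_form vol4 *m A^T = dvol k *: lam2_inner k.
  split=> [->|H].
    rewrite /hodge linearZ /= trmx_mul !trmxK -scalemxAr mulmxA.
    by rewrite mulmxV ?vol4_unit // mul1mx.
  apply/(can_inj trmxK).
  rewrite /hodge linearZ /= trmx_mul !trmxK scalemxAr -H.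
  by rewrite mulmxA mulVmx ?vol4_unit // mul1mx.
split=> [/E3 H xi eta|H]; first by rewrite E1 E2 H.
by apply/E3/gram_form_inj => xi eta; rewrite -E1 -E2.
Qed.

Lemma wedge_pairingE (k : 'M[R]_4) (xi eta : L2) : dvol k != 0 ->
  gram_form (wedge_pairing k) xi eta * dvol k = wedge22 xi eta.
Proof.
move=> k0; rewrite /wedge22 /gram_form -scalemxAr -scalemxAl mxE mulrAC.
by rewrite mulVf // mul1r.
Qed.

Lemma curv_opP (g : E -> 'M[R]_4) (x : E) (A : 'M[R]_6) : dvol (g x) != 0 ->
  A = curv_op g x <->
  forall xi eta : L2,
    gram_form (wedge_pairing (g x)) (xi *m A) eta =
    gram_form (lam2_form (riem g x)) xi eta.
Proof.
move=> k0.
have u : wedge_pairing (g x) \in unitmx.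
  by rewrite unitmxZ ?vol4_unit // unitfE invr_eq0.
have E1 xi eta : gram_form (wedge_pairing (g x)) (xi *m A) eta =
    gram_form (A *m wedge_pairing (g x)) xi eta.
  by rewrite /gram_form !mulmxA.
split=> [H xi eta|H]; first by rewrite E1 H /curv_op mulmxKV.
rewrite -[A](mulmxK u) /curv_op; congr (_ *m _).
by apply/gram_form_inj => xi eta; rewrite -E1.
Qed.

Lemma inner_product_det_neq0 (k : 'M[R]_4) : inner_product k -> \det k != 0.
Proof.
case=> _ pos; apply/negP => /det0P [v v0 vk].
by have := pos v v0; rewrite /gram_form vk mul0mx mxE ltxx.
Qed.

Lemma inner_product_det_gt0 (k : 'M[R]_4) : inner_product k -> 0 < \det k.
Proof.
move=> kin.
pose P : 'M[{poly R}]_4 := map_mx polyC 1%:M + 'X *: map_mx polyC (k - 1%:M).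
have PE t : (\det P).[t] = \det (1%:M + t *: (k - 1%:M)).
  rewrite -[_.[t]]/(horner_eval t _) -det_map_mx; congr (\det _).
  by apply/matrixP => i j; rewrite !mxE /= /horner_eval !hornerE.
have Pn t : 0 <= t <= 1 -> (\det P).[t] != 0.
  move=> /andP[t0 t1]; rewrite PE; apply: inner_product_det_neq0.
  have S v w : gram_form (1%:M + t *: (k - 1%:M)) v w =
      (1 - t) * gram_form 1%:M v w + t * gram_form k v w.
    rewrite /gram_form mulmxDr mulmxDl -scalemxAr -scalemxAl.
    by rewrite mulmxBr mulmxBl !mxE; ring.
  case: kin => ksym kpos.
  have Isym v w : gram_form 1%:M v w = gram_form 1%:M w v :> R.
    rewrite /gram_form !mulmx1 !mxE.
    by apply: eq_bigr => i _; rewrite !mxE mulrC.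
  split=> [v w|v v0]; first by rewrite !S ksym Isym.
  have Ipos : 0 < gram_form 1%:M v v.
    have [i vi] : exists i, v 0 i != 0.
      apply/existsP; apply: contraNT v0; rewrite negb_exists => /forallP H.
      by apply/eqP/rowP => i; rewrite mxE; apply/eqP; have := H i; rewrite negbK.
    rewrite /gram_form mulmx1 mxE (bigD1 i) //= mxE -expr2.
    rewrite ltr_pwDl ?exprn_even_gt0 //.
    by apply: sumr_ge0 => j _; rewrite mxE -expr2 sqr_ge0.
  rewrite S; have := kpos v v0 => kv.
  have [->|t1'] := eqVneq t 1; first by rewrite subrr mul0r add0r mul1r.
  rewrite ltr_pwDl //; last by rewrite mulr_ge0 // ltW.
  by rewrite mulr_gt0 // subr_gt0 lt_neqAle t1' t1.
have P0 : (\det P).[0] = 1 by rewrite PE scale0r addr0 det1.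
have P1 : (\det P).[1] = \det k by rewrite PE scale1r addrC subrK.
rewrite -P1 ltNge; apply/negP => P1le.
have [||t tI /eqP rt] := @Num.Theory.poly_ivt R (- \det P) 0 1.
- exact: ler01.
- by rewrite !hornerN P0 oppr_le0 ler01 oppr_ge0.
by have := Pn t tI; rewrite -oppr_eq0 -hornerN rt eqxx.
Qed.

Lemma dvol_gt0 (k : 'M[R]_4) : inner_product k -> 0 < dvol k.
Proof. by move=> /inner_product_det_gt0 k0; rewrite invr_gt0 sqrtr_gt0. Qed.

(* [dvol k] is a k-unit element: the square of its k-length is 1. *)
Lemma dvol_unit (k : 'M[R]_4) : inner_product k -> dvol k ^+ 2 * \det k = 1.
Proof.
move=> /inner_product_det_gt0 k0.
by rewrite /dvol exprVn sqr_sqrtr ?ltW // mulVf ?gt_eqF.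
Qed.

End Bivectors.

(* Main.v *)
(* If A commutes with the Hodge star of h, then the induced inner product
   <x, y> ~ Q(x, *y) on bivectors makes A self-adjoint, hence diagonalizable.
   Conversely, a diagonalizable Q-self-adjoint A has a Q-orthogonal eigenbasis,
   and since Q has signature (3, 3) three of its members, x1, x2, x3, are
   Q-positive.  Reading a bivector x as a skew 4 x 4 matrix X and its dual as
   X', one has the Clifford relations X Y' + Y X' = - Q(x, y), so that Urbantke's
   matrix h = X1' X2 X3' is symmetric, definite, and satisfies h X h ~ X' for
   x = x1, x2, x3 and h X h ~ - X' for x orthogonal to all three.  Thus every
   eigenvector of A is an eigenvector of the Hodge star of +-h.
   The Q-self-adjointness of the curvature operator is the pair symmetry of the
   Riemann tensor, which rests on the symmetry of second derivatives. *)

Require Import Defs.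
From HB Require Import structures.
From mathcomp Require Import all_boot all_order all_algebra.
From mathcomp Require Import all_classical all_reals all_analysis.
From mathcomp Require Import ring lra zify.
From mathcomp Require complex.

Set Implicit Arguments.
Unset Strict Implicit.
Unset Printing Implicit Defensive.

Import Order.TTheory GRing.Theory Num.Theory.
Import numFieldNormedType.Exports.

Local Open Scope ring_scope.

(** * Self-adjoint operators *)

Section RealFactor.
Import (canonicals) complex.
Variable R : rcfType.
Local Notation toC := (complex.real_complex_def (Phant R)).

(** A complex root of p is either real, giving a linear factor, or comes with its conjugate; in the
    second case the two coprime linear factors multiply to a real quadratic, kept as a sum of
    squares with a = Re z and b = Im z. *)
Lemma real_factor (p : {poly R}) : (1 < size p)%N ->
  exists a b q, (b != 0 /\ p = (('X - a%:P) ^+ 2 + (b ^+ 2)%:P) * q)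
             \/ p = ('X - a%:P) * q.
Proof.
move=> p1; have [z pz] : exists z : complex.complex R, root (map_poly toC p) z.
  by apply/closed_rootP; rewrite size_map_poly gtn_eqF.
have [/eqP z0|z0] := boolP (complex.Im z == 0).
  have /factor_theorem[q ->] : root p (complex.Re z).
    by rewrite -(fmorph_root toC) /=; case: z z0 pz => a b /= ->.
  by exists (complex.Re z), 0, q; right; rewrite mulrC.
have pz' : root (map_poly toC p) (complex.conjc z).
  rewrite -complex.complex_root_conj -map_poly_comp /=.
  by rewrite (eq_map_poly (g := toC)) // => x; exact: complex.conjc_real.
pose a := complex.Re z; pose b := complex.Im z.
have /dvdpP[q ->] : ('X - a%:P) ^+ 2 + (b ^+ 2)%:P %| p.
  rewrite -(dvdp_map toC).
  have -> : map_poly toC (('X - a%:P) ^+ 2 + (b ^+ 2)%:P) =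
      ('X - z%:P) * ('X - (complex.conjc z)%:P).
    have -> : ('X - z%:P) * ('X - (complex.conjc z)%:P) =
        'X ^+ 2 - (z + complex.conjc z)%:P * 'X + (z * complex.conjc z)%:P
        :> {poly complex.complex R}.
      by rewrite polyCD polyCM; ring.
    rewrite complex.addcJ -complex.sqr_normc -complex.add_Re2_Im2 -/a -/b.
    rewrite rmorphD rmorphXn rmorphB /= map_polyX !map_polyC /=.
    rewrite !rmorphD /= polyCM rmorphXn /= [in RHS]polyCD rmorphXn /=.
    by ring.
  rewrite Gauss_dvdp ?dvdp_XsubCl ?pz ?pz' //.
  rewrite coprimep_XsubC2 // -opprB oppr_eq0 complex.subcJ.
  rewrite !mulf_neq0 ?pnatr_eq0 //.
  - by rewrite complex.eq_complex /= negb_and z0.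
  - by rewrite complex.eq_complex /= oner_eq0 andbF.
by exists a, b, q; left; rewrite mulrC z0.
Qed.

End RealFactor.

(** * Real spectral theorem, by way of the minimal polynomial *)

Section PositiveForms.
Variable R : realType.

Definition posform n (G : 'M[R]_n) :=
  forall v : 'rV_n, v != 0 -> 0 < gram_form G v v.

Lemma gram_form_row m n (G : 'M[R]_n) (Y : 'M[R]_(m, n)) i j :
  gram_form G (row i Y) (row j Y) = (Y *m G *m Y^T) i j.
Proof.
by rewrite /gram_form tr_row -row_mul !mxE; apply: eq_bigr => k _; rewrite !mxE.
Qed.

Lemma posform_ge0 n (G : 'M[R]_n) v : posform G -> 0 <= gram_form G v v.
Proof.
move=> Gpos; have [->|/Gpos/ltW//] := eqVneq v 0.
by rewrite /gram_form trmx0 mulmx0 mxE.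
Qed.

(** Each diagonal entry is the squared G-length of a row of Y plus [b ^+ 2] times that of a row of
    F; both terms are nonnegative, so both vanish. *)
Lemma sum_squares_eq0 m n (G : 'M[R]_n) (Y F : 'M[R]_(m, n)) b : posform G ->
  Y *m G *m Y^T + b ^+ 2 *: (F *m G *m F^T) = 0 -> Y = 0 /\ (b = 0 \/ F = 0).
Proof.
move=> Gpos /matrixP YF0.
have YFi k : gram_form G (row k Y) (row k Y) = 0 /\
    b ^+ 2 * gram_form G (row k F) (row k F) = 0.
  have := YF0 k k; rewrite !gram_form_row [RHS]mxE mxE [X in _ + X]mxE => /eqP.
  rewrite paddr_eq0 -?gram_form_row ?(mulr_ge0 (sqr_ge0 _)) ?posform_ge0 //.
  by case/andP=> /eqP-> /eqP->.
have rowP0 (Z : 'M[R]_(m, n)) :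
    (forall i, gram_form G (row i Z) (row i Z) = 0) -> Z = 0.
  move=> Z0; apply/row_matrixP => i; rewrite row0.
  by apply: contra_eq (Z0 i) => /Gpos; rewrite lt0r => /andP[].
split; first by apply: rowP0 => k; have [] := YFi k.
have [->|b0] := eqVneq b 0; [by left|right].
apply: rowP0 => k; have [_ /eqP] := YFi k.
by rewrite mulf_eq0 sqrf_eq0 (negPf b0) => /eqP.
Qed.

(** It suffices that the minimal polynomial divides a product of distinct real linear factors. Such
    a product is reached by reducing an annihilating polynomial factor by factor. *)
Lemma selfadjoint_diagonalizable n (G A : 'M[R]_n.+1) : posform G ->
  A *m G = G *m A^T -> diagonalizable A.
Proof.
move=> Gpos AG.
have hG p : horner_mx A p *m G = G *m (horner_mx A p)^T.
  elim/poly_ind: p => [|p c IH]; first by rewrite rmorph0 mul0mx trmx0 mulmx0.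
  rewrite rmorphD rmorphM /= horner_mx_X horner_mx_C linearD /= mulmxDl mulmxDr.
  rewrite tr_scalar_mx scalar_mxC; congr (_ + _).
  have pA : horner_mx A p *m A = A *m horner_mx A p.
    rewrite -[X in _ *m X]horner_mx_X mulmxE -rmorphM mulrC rmorphM /=.
    by rewrite horner_mx_X.
  by rewrite -!mulmxE [in RHS]pA -mulmxA AG mulmxA IH -mulmxA trmx_mul.
(* With F = f(A), this reads |(A - a) F|^2 + b^2 |F|^2 = 0: irreducible
   quadratic factors and repeated roots can be dropped from a polynomial that
   annihilates A. *)
have quad0 a b f : horner_mx A ((('X - a%:P) ^+ 2 + (b ^+ 2)%:P) * f) = 0 ->
    horner_mx A (('X - a%:P) * f) = 0 /\ (b = 0 \/ horner_mx A f = 0).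
  move=> h0; apply: sum_squares_eq0 (Gpos) _.
  rewrite -!mulmxA -!hG !mulmxA !mulmxE -!rmorphM scalemxAl -horner_mxZ.
  rewrite -mulmxDl -rmorphD.
  have -> : ('X - a%:P) * f * (('X - a%:P) * f) + b ^+ 2 *: (f * f)
      = (('X - a%:P) ^+ 2 + (b ^+ 2)%:P) * f * f by rewrite -mul_polyC; ring.
  by rewrite rmorphM /= h0 mul0r mul0mx.
(* Induction on the size of p, the part still to be factored; f collects the linear factors already
   extracted. *)
have split_roots k : forall p f : {poly R}, (size p < k)%N -> p != 0 ->
    horner_mx A (p * f) = 0 -> exists2 rs, uniq rs &
    horner_mx A (\prod_(r <- rs) ('X - r%:P) * f) = 0.
  elim: k => // k IH p f; rewrite ltnS => pk p0 pf0.
  have [p1|p1] := leqP (size p) 1.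
    exists [::] => //; rewrite big_nil mul1r.
    move: pf0 p0; rewrite (size1_polyC p1) mul_polyC horner_mxZ polyC_eq0.
    by move=> /eqP; rewrite scaler_eq0 => /orP[->|/eqP].
  have [a [b [q pE]]] := real_factor p1.
  have q0 : q != 0.
    by apply: contraNneq p0 => q0; case: pE => [[_]|] ->; rewrite q0 mulr0.
  have quad_size : size (('X - a%:P) ^+ 2 + (b ^+ 2)%:P) = 3%N.
    rewrite size_polyDl size_exp_XsubC //.
    exact: leq_ltn_trans (size_polyC_leq1 _) _.
  have qk : (size q < k)%N.
    apply: leq_trans pk; case: (pE) => [[_]|] ->.
      by rewrite size_mul -?size_poly_eq0 ?quad_size // size_poly_eq0.
    by rewrite size_mul ?polyXsubC_eq0 // size_XsubC.
  case: pE => [[bn0 pE]|pE].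
    apply: (IH q f qk q0); move: pf0; rewrite pE -mulrA => /quad0[_ [b0|//]].
    by rewrite b0 eqxx in bn0.
  have [|rs rsU rs0] := IH q (('X - a%:P) * f) qk q0.
    by rewrite mulrA [q * _]mulrC -pE.
  have [ars|ars] := boolP (a \in rs); last first.
    exists (a :: rs); rewrite /= ?ars // big_cons.
    by rewrite -mulrA mulrCA.
  exists rs => //.
  (* The root a now occurs twice; [quad0] with b = 0 drops one of the two copies. *)
  move: rs0; rewrite (big_rem a) //= -!mulrA.
  set t := \prod_(_ <- _) _ => t0.
  have [|] := quad0 a 0 (t * f); last by rewrite mulrA.
  by rewrite expr0n addr0 -[RHS]t0; congr horner_mx; ring.
apply/mxred.diagonalizableP.
have [||rs rsU rs0] := split_roots _ (mxminpoly A) 1 (leqnn _).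
- by rewrite monic_neq0 // mxminpoly_monic.
- by rewrite mulr1 mx_root_minpoly.
by exists rs => //; rewrite mxminpoly_min // -[X in horner_mx _ X]mulr1.
Qed.

End PositiveForms.

(** * Orthogonal eigenbases for a nondegenerate, possibly indefinite form *)

Section OrthogonalEigenbasis.
Variables (R : realType) (n : nat) (S A P : 'M[R]_n) (D : 'rV[R]_n).
Hypothesis S_sym : S^T = S.
Hypothesis S_unit : S \in unitmx.
Hypothesis AS_sym : A *m S = S *m A^T.
Hypothesis P_unit : P \in unitmx.
Hypothesis PA : P *m A = diag_mx D *m P.

Lemma gram_form_sym v w : gram_form S v w = gram_form S w v.
Proof.
rewrite /gram_form -[in LHS](trmxK (v *m S *m w^T)) [LHS]mxE.
by rewrite !trmx_mul trmxK S_sym mulmxA.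
Qed.

Definition orthogonal_eigenvectors k (V : 'M[R]_(k, n)) (d q : 'rV[R]_k) :=
  [/\ V *m A = diag_mx d *m V, V *m S *m V^T = diag_mx q
    & forall i, q 0 i != 0].

(* Pi is the S-orthogonal projection away from the rows of V; it commutes with
   A, so it maps the eigenbasis P to eigenvectors orthogonal to V, and two of these
   have a nonzero product because Pi *m S is not zero. *)
Lemma anisotropic_eigenvector k (V : 'M[R]_(k, n)) d q : (k < n)%N ->
  orthogonal_eigenvectors V d q ->
  exists (r : 'rV_n) a,
    [/\ r *m A = a *: r, r *m S *m V^T = 0 & gram_form S r r != 0].
Proof.
move=> kn [VA VSV q0].
pose Q := diag_mx q; pose Qi := diag_mx (\row_i (q 0 i)^-1).
have QiQ : Qi *m Q = 1%:M.
  rewrite mulmx_diag -diag_const_mx; congr diag_mx; apply/rowP => i.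
  by rewrite !mxE mulVf.
have QiD : diag_mx d *m Qi = Qi *m diag_mx d by rewrite diag_mxC.
pose T := S *m V^T *m Qi *m V; pose Pi := 1%:M - T.
have ATC : A *m T = T *m A.
  have -> : A *m T = S *m (V *m A)^T *m Qi *m V.
    by rewrite /T !mulmxA AS_sym trmx_mul !mulmxA.
  rewrite VA trmx_mul tr_diag_mx /T -!mulmxA VA; congr (_ *m _); congr (_ *m _).
  by rewrite !mulmxA QiD.
have APi : A *m Pi = Pi *m A by rewrite mulmxBr mulmxBl mulmx1 mul1mx ATC.
have PiSV : Pi *m S *m V^T = 0.
  rewrite !mulmxBl mul1mx /T -!mulmxA (mulmxA V) VSV QiQ mulmx1.
  by rewrite subrr.
have PiS_sym : (Pi *m S)^T = Pi *m S.
  rewrite trmx_mul S_sym /Pi linearB /= trmx1 mulmxBr mulmxBl mulmx1 mul1mx.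
  by rewrite /T !trmx_mul trmxK tr_diag_mx S_sym !mulmxA.
have PiS0 : Pi *m S != 0.
  apply/eqP => PS0.
  have Pi0 : Pi = 0 by rewrite -[Pi](mulmxK S_unit) PS0 mul0mx.
  have : (\rank T <= k)%N.
    by rewrite /T (leq_trans (mxrankM_maxr _ _)) ?rank_leq_row.
  have -> : T = 1%:M by apply/esym/eqP; rewrite -subr_eq0 -/Pi Pi0.
  by rewrite mxrank1 leqNgt kn.
pose B := P *m Pi.
have BA : B *m A = diag_mx D *m B by rewrite -mulmxA -APi mulmxA PA mulmxA.
have BSV : B *m S *m V^T = 0 by rewrite /B -!mulmxA (mulmxA Pi) PiSV mulmx0.
have BSB0 : B *m S *m B^T != 0.
  have -> : B *m S *m B^T = P *m (Pi *m S) *m P^T.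
    rewrite /B trmx_mul.
    have -> : P *m Pi *m S *m (Pi^T *m P^T) = P *m (Pi *m (S *m Pi^T)) *m P^T.
      by rewrite !mulmxA.
    have -> : S *m Pi^T = Pi *m S by rewrite -[RHS]PiS_sym trmx_mul S_sym.
    congr (_ *m _ *m _).
    have -> : Pi *m (Pi *m S) = Pi *m S - Pi *m S *m V^T *m Qi *m V *m S.
      have {1}-> : Pi *m S = S - T *m S by rewrite mulmxBl mul1mx.
      by rewrite mulmxBr /T !mulmxA.
    by rewrite PiSV !mul0mx subr0.
  apply: contraNneq PiS0 => PPS0.
  have PT_unit : P^T \in unitmx by rewrite unitmx_tr.
  rewrite -[Pi *m S](mulKmx P_unit) -[X in invmx _ *m X](mulmxK PT_unit).
  by rewrite PPS0 mul0mx mulmx0.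
have BiA i : row i B *m A = D 0 i *: row i B.
  by rewrite -row_mul BA row_mul row_diag_mx -scalemxAl -rowE.
have BiSV i : row i B *m S *m V^T = 0 by rewrite -!row_mul BSV row0.
have [i [j Bij]] : exists i j, gram_form S (row i B) (row j B) != 0.
  apply: contraPP BSB0 => H; apply/negP; rewrite negbK.
  apply/eqP/matrixP => i j.
  rewrite -gram_form_row mxE; apply/eqP/negP => Bij; apply: H.
  by exists i, j; apply/negP.
have [Bii|Bii] := boolP (gram_form S (row i B) (row i B) == 0); last first.
  by exists (row i B), (D 0 i).
have [Bjj|Bjj] := boolP (gram_form S (row j B) (row j B) == 0); last first.
  by exists (row j B), (D 0 j).
(* Rows i and j are isotropic but not orthogonal. Eigenvectors with distinct eigenvalues would be
   orthogonal, so the eigenvalues agree, and the sum of the rows is an eigenvector whose square is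
   twice their product. *)
have Dij : D 0 i = D 0 j.
  apply: (mulIf Bij); rewrite -[LHS]addr0.
  have := congr1 (fun M => (row i B *m M *m (row j B)^T) 0 0) AS_sym.
  rewrite /gram_form mulmxA BiA -!mulmxA -trmx_mul BiA linearZ /=.
  by rewrite -scalemxAl -!scalemxAr !mxE addr0.
exists (row i B + row j B), (D 0 i); split.
- by rewrite mulmxDl !BiA Dij scalerDr.
- by rewrite !mulmxDl !BiSV addr0.
have -> : gram_form S (row i B + row j B) (row i B + row j B) =
    gram_form S (row i B) (row j B) *+ 2.
  have E v w : gram_form S (v + w) (v + w) =
     gram_form S v v + gram_form S w w + gram_form S v w *+ 2.
    rewrite -[v]scale1r gram_form_linl scale1r !mul1r.
    rewrite -[v]scale1r !gram_form_linr.
    by rewrite !scale1r !mul1r (gram_form_sym w v); ring.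
  by rewrite E (eqP Bii) (eqP Bjj) !add0r.
by rewrite mulrn_eq0 negb_or.
Qed.

Lemma orthogonal_eigenvectors_exist k : (k <= n)%N ->
  exists (V : 'M[R]_(k, n)) d q, orthogonal_eigenvectors V d q.
Proof.
elim: k => [_|k IH kn].
  exists 0, 0, 0; split=> [||[]//]; apply/matrixP => -[]//.
have [V [d [q Vdq]]] := IH (ltnW kn).
have [r [a [rA rSV rr]]] := anisotropic_eigenvector kn Vdq.
have [VA VSV q0] := Vdq.
change (exists V d q, @orthogonal_eigenvectors (1 + k) V d q).
exists (col_mx r V), (row_mx a%:M d), (row_mx (r *m S *m r^T) q); split.
- rewrite mul_col_mx diag_mx_row mul_block_col !mul0mx addr0 add0r VA rA.
  congr col_mx; rewrite -mul_scalar_mx; congr (_ *m _).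
  by apply/matrixP => i j; rewrite !mxE !ord1.
- rewrite mul_col_mx tr_col_mx mul_col_row diag_mx_row VSV rSV.
  congr block_mx.
    by apply/matrixP => i j; rewrite [RHS]mxE !ord1 mulr1n.
  have -> : V *m S *m r^T = (r *m S *m V^T)^T.
    by rewrite !trmx_mul trmxK S_sym mulmxA.
  by rewrite rSV trmx0.
- move=> i; rewrite mxE; case: splitP => j _; last exact: q0.
  by rewrite ord1.
Qed.

(** The Gram matrix of n such eigenvectors is diagonal without zeros, hence invertible, which forces
    V to be invertible. *)
Lemma orthogonal_eigenbasis : exists (V : 'M[R]_n) d q,
  V \in unitmx /\ orthogonal_eigenvectors V d q.
Proof.
have [V [d [q Vdq]]] := orthogonal_eigenvectors_exist (leqnn n).
exists V, d, q; split=> //; have [_ VSV q0] := Vdq.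
have : V *m S *m V^T \in unitmx.
  rewrite VSV unitmxE det_diag unitfE; apply/prodf_neq0 => i _; exact: q0.
by rewrite !unitmx_mul => /andP[/andP[]].
Qed.
End OrthogonalEigenbasis.

(** * Bivectors as skew matrices *)

Lemma big_ord4 (V : nmodType) (F : 'I_4 -> V) :
  \sum_i F i = F 0 + F 1 + F 2 + F 3.
Proof.
rewrite !big_ord_recr big_ord0 /= add0r.
by congr (F _ + F _ + F _ + F _); apply/val_inj.
Qed.

Lemma big_ord6 (V : nmodType) (F : 'I_6 -> V) :
  \sum_i F i = F 0 + F 1 + F 2 + F 3 + F 4 + F 5.
Proof.
rewrite !big_ord_recr big_ord0 /= add0r.
by congr (F _ + F _ + F _ + F _ + F _ + F _); apply/val_inj.
Qed.

Section SkewMatrices.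
Variable R : realType.
Implicit Types (x y w : 'rV[R]_6) (h : 'M[R]_4).

Local Notation S := (lam2_form (@vol4 R)).

(** Under this identification v /\ w becomes the matrix v^T w - w^T v. *)
Definition skew w : 'M[R]_4 := \sum_a w 0 a *:
  (delta_mx (bidx a).1 (bidx a).2 - delta_mx (bidx a).2 (bidx a).1).

Lemma skew_is_linear : linear skew.
Proof.
move=> c x y; rewrite /skew scaler_sumr -big_split; apply: eq_bigr => a _ /=.
by rewrite !mxE scalerDl scalerA.
Qed.
HB.instance Definition _ := GRing.isLinear.Build R 'rV[R]_6 'M[R]_4 _ skew
  skew_is_linear.

Lemma skewE w : skew w = \matrix_(i, j) nth 0 (nth [::]
  [:: [:: 0; w 0 0; w 0 1; w 0 2];
      [:: - w 0 0; 0; w 0 3; w 0 4];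
      [:: - w 0 1; - w 0 3; 0; w 0 5];
      [:: - w 0 2; - w 0 4; - w 0 5; 0]] i) j.
Proof.
apply/matrixP => i j; rewrite !mxE summxE big_ord6 /= !mxE.
by case: i => [[|[|[|[|//]]]] ?]; case: j => [[|[|[|[|//]]]] ?] /=; ring.
Qed.

(** In the chosen basis S is also the Hodge star of the Euclidean inner product, so [skew (w *m S)]
    is the dual matrix X' of X = [skew w]. *)
Lemma wedge_dualE w : w *m S = \row_a nth 0
  [:: w 0 5; - w 0 4; w 0 3; w 0 2; - w 0 1; w 0 0] a.
Proof.
apply/rowP => a; rewrite !mxE.
under eq_bigr do rewrite vol4_gramE.
rewrite big_ord6 /=.
by case: a => [[|[|[|[|[|[|//]]]]]] ?] /=; rewrite ?expr0 ?expr1; ring.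
Qed.

Lemma skew_tr w : (skew w)^T = - skew w.
Proof.
rewrite /skew linear_sum -sumrN; apply: eq_bigr => a _ /=.
by rewrite linearZ linearB /= !trmx_delta -scalerN opprB.
Qed.

(** Polarized form of X X' = - Pf(X), where Q(x, x) is twice the Pfaffian. *)
Lemma skew_clifford x y :
  skew x *m skew (y *m S) + skew y *m skew (x *m S) = - (gram_form S x y)%:M.
Proof.
rewrite /gram_form !wedge_dualE !skewE.
apply/matrixP => i j; rewrite !mxE !big_ord4 !big_ord6 /= !mxE.
by case: i => [[|[|[|[|//]]]] ?]; case: j => [[|[|[|[|//]]]] ?] /=;
  rewrite ?mulr1n ?mulr0n; ring.
Qed.

(** Duality is an involution and an isometry of Q, so the relation may be applied to the duals. *)
Lemma skew_clifford_dual x y :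
  skew (x *m S) *m skew y + skew (y *m S) *m skew x = - (gram_form S x y)%:M.
Proof.
have := skew_clifford (x *m S) (y *m S).
rewrite -!mulmxA vol4_gramV !mulmx1 => ->.
rewrite /gram_form trmx_mul !mulmxA -[_ *m S *m S]mulmxA vol4_gramV mulmx1.
by rewrite vol4_gram_sym.
Qed.

Lemma skew_entry w a : w 0 a = skew w (bidx a).1 (bidx a).2.
Proof.
rewrite skewE mxE /bidx (tnth_nth (0, 0)).
by case: a => [[|[|[|[|[|[|//]]]]]] ?] /=; congr (w _ _); apply/val_inj.
Qed.

Lemma skew_inj : injective skew.
Proof. by move=> x y xy; apply/rowP => a; rewrite !skew_entry xy. Qed.

Lemma skew_mx_eq (M N : 'M[R]_4) : M^T = - M -> N^T = - N ->
  (forall a, M (bidx a).1 (bidx a).2 = N (bidx a).1 (bidx a).2) -> M = N.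
Proof.
have skewK (K : 'M[R]_4) :
    K^T = - K -> K = skew (\row_a K (bidx a).1 (bidx a).2).
  move=> Kskew; have KE i j : K i j = - K j i.
    by have /matrixP/(_ j i) := Kskew; rewrite !mxE.
  pose F k l := K (inord k) (inord l).
  have KF i j : K i j = F i j by rewrite /F !inord_val.
  have F0 k : F k k = 0.
    by have := KE (inord k) (inord k); rewrite -/(F k k); lra.
  have FE k l : F k l = - F l k by exact: KE.
  rewrite skewE; apply/matrixP => i j; rewrite !mxE !KF /=.
  case: i => [[|[|[|[|//]]]] ?]; case: j => [[|[|[|[|//]]]] ?] /=;
    by [exact: F0 | exact: FE |].
move=> Ms Ns MN; rewrite (skewK _ Ms) (skewK _ Ns); congr skew.
by apply/rowP => a; rewrite !mxE.
Qed.

Lemma gram_form_ebase n (M : 'M[R]_n) i j :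
  gram_form M (delta_mx 0 i) (delta_mx 0 j) = M i j.
Proof. by rewrite /gram_form -rowE trmx_delta -colE !mxE. Qed.

(** The induced form lowers both indices of a bivector with h. *)
Lemma skew_lam2_inner h w : h^T = h ->
  skew (w *m lam2_inner h) = h *m skew w *m h.
Proof.
move=> h_sym; apply: skew_mx_eq; first exact: skew_tr.
  by rewrite !trmx_mul h_sym skew_tr mulNmx mulmxN mulmxA.
move=> b; rewrite -skew_entry mxE /skew.
rewrite mulmx_sumr mulmx_suml summxE; apply: eq_bigr => a _.
rewrite -scalemxAr -scalemxAl [RHS]mxE; congr (_ * _).
rewrite mxE !gram_form_ebase mulmxBr mulmxBl [RHS]mxE [X in _ = _ + X]mxE.
have E i j k l : (h *m delta_mx i j *m h) k l = h i k * h j l.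
  rewrite -(mul_delta_mx (0 : 'I_1)) mulmxA -colE -mulmxA -rowE mxE big_ord1.
  rewrite !mxE.
  by congr (_ * _); rewrite -[in LHS]h_sym mxE.
by rewrite !E mulrC; congr (_ - _); rewrite mulrC.
Qed.

(** The trace runs over ordered index pairs, the Gram form over pairs i < j, whence the factor 2. *)
Lemma lam2_inner_trace h x y : h^T = h ->
  gram_form (lam2_inner h) x y *+ 2 = \tr (h *m skew x *m h *m (skew y)^T).
Proof.
move=> h_sym; rewrite -skew_lam2_inner // /gram_form.
set z := x *m _; rewrite !skewE mxE /mxtrace big_ord4 big_ord6 !mxE.
by rewrite !big_ord4 !mxE /=; ring.
Qed.

(** In an h-orthogonal basis with squared lengths [q], twice the square of a bivector is the sum of
    [q 0 i * q 0 j * Z i j ^+ 2], where Z holds its components in that basis. *)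
Lemma lam2_inner_pos h : inner_product h -> posform (lam2_inner h).
Proof.
move=> hin; have [hsym hpos] := hin.
have h_sym : h^T = h.
  by apply/matrixP => i j; rewrite mxE -!gram_form_ebase hsym.
have h_unit : h \in unitmx.
  by rewrite unitmxE unitfE inner_product_det_neq0.
(* For the identity operator every vector is an eigenvector, so the eigenbasis theorem merely
   supplies an h-orthogonal basis. *)
have [V [d [q [V_unit [_ VhV _]]]]] : exists V d q,
    V \in unitmx /\ orthogonal_eigenvectors h 1%:M V d q.
  apply: (@orthogonal_eigenbasis _ _ h 1%:M 1%:M (const_mx 1)) => //.
  - by rewrite trmx1 mulmx1 mul1mx.
  - exact: unitmx1.
  - by rewrite diag_const_mx.
have q0 i : 0 < q 0 i.
  have -> : q 0 i = gram_form h (row i V) (row i V).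
    by rewrite gram_form_row VhV mxE eqxx mulr1n.
  apply: hpos; apply/eqP => Vi0.
  have /(congr1 (row i)) := mulmxV V_unit.
  rewrite row_mul Vi0 mul0mx => /rowP/(_ i).
  by rewrite !mxE eqxx => /esym/eqP; rewrite oner_eq0.
pose W := invmx V.
have hE : h = W *m diag_mx q *m W^T.
  rewrite -VhV !mulmxA mulVmx // mul1mx -mulmxA -trmx_mul mulVmx //.
  by rewrite trmx1 mulmx1.
move=> x x0; rewrite -(pmulrn_lgt0 _ (isT : 0 < 2)%N) lam2_inner_trace //.
pose Z := W^T *m skew x *m W.
have -> : \tr (h *m skew x *m h *m (skew x)^T) =
    \sum_i \sum_j q 0 i * q 0 j * Z i j ^+ 2.
  have -> : \tr (h *m skew x *m h *m (skew x)^T) =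
      \tr (diag_mx q *m Z *m diag_mx q *m Z^T).
    rewrite hE /Z !trmx_mul trmxK -!mulmxA mxtrace_mulC !mulmxA.
    by rewrite mxtrace_mulC !mulmxA.
  apply: eq_bigr => i _; rewrite mxE; apply: eq_bigr => j _.
  by rewrite mul_mx_diag mul_diag_mx !mxE; ring.
have [[i j] Zij] : exists ij, Z ij.1 ij.2 != 0.
  apply/existsP; apply: contraNT x0; rewrite negb_exists => /forallP Z0.
  apply/eqP/skew_inj; rewrite linear0.
  have Z00 : Z = 0.
    apply/matrixP => i j; rewrite [RHS]mxE; apply/eqP.
    by have := Z0 (i, j); rewrite negbK.
  have -> : skew x = V^T *m Z *m V.
    rewrite /Z !mulmxA -trmx_mul mulVmx // trmx1 mul1mx -mulmxA mulVmx //.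
    by rewrite mulmx1.
  by rewrite Z00 mulmx0 mul0mx.
have t0 k l : 0 <= q 0 k * q 0 l * Z k l ^+ 2.
  by rewrite mulr_ge0 ?sqr_ge0 // mulr_ge0 // ltW.
rewrite (bigD1 i) //= (bigD1 j) //= -addrA ltr_pwDl //.
  by rewrite (mulr_gt0 (mulr_gt0 (q0 i) (q0 j))) // exprn_even_gt0.
by rewrite addr_ge0 ?sumr_ge0 // => k _; rewrite sumr_ge0.
Qed.

End SkewMatrices.

(** * The Hodge star as a matrix, and diagonalizability from commutation *)

Section HodgeStar.
Variable R : realType.
Implicit Types (x y z w : 'rV[R]_6) (h : 'M[R]_4).

Local Notation S := (lam2_form (@vol4 R)).

Lemma inner_product_sym h : inner_product h -> h^T = h.
Proof.
by case=> hsym _; apply/matrixP => i j; rewrite mxE -!gram_form_ebase hsym.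
Qed.

Lemma lam2_inner_sym h : h^T = h -> (lam2_inner h)^T = lam2_inner h.
Proof.
move=> h_sym; have hC i j : h i j = h j i by rewrite -{1}h_sym mxE.
apply/matrixP => a b; rewrite !mxE !gram_form_ebase.
by rewrite ![h (bidx b).1 _]hC ![h (bidx b).2 _]hC [X in _ - X]mulrC.
Qed.

Lemma invmx_vol4 : invmx S = S.
Proof. by rewrite -[RHS](mulKmx vol4_unit) vol4_gramV mulmx1. Qed.

Lemma hodgeE h : h^T = h -> hodge h = dvol h *: (lam2_inner h *m S).
Proof.
by move=> h_sym; rewrite /hodge lam2_inner_sym // invmx_vol4 vol4_gram_sym.
Qed.

Lemma comm_hodge_diagonalizable (A : 'M[R]_6) h : inner_product h ->
  A *m S = S *m A^T -> comm_mx A (hodge h) -> diagonalizable A.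
Proof.
move=> hin AS AH; have h_sym := inner_product_sym hin.
apply: (selfadjoint_diagonalizable (lam2_inner_pos hin)).
(* Since S squares to 1, the inner product is recovered from the star. A then passes the star by
   commutation and S by Q-self-adjointness. *)
have -> : lam2_inner h = (dvol h)^-1 *: (hodge h *m S).
  rewrite hodgeE // -scalemxAl -mulmxA vol4_gramV mulmx1 scalerA.
  by rewrite mulVf ?scale1r // gt_eqF // dvol_gt0.
move: (hodge h) AH => H AH; rewrite -scalemxAr -scalemxAl; congr (_ *: _).
by rewrite mulmxA AH -!mulmxA AS.
Qed.

End HodgeStar.

(** * The Urbantke metric *)

Section Urbantke.
Variable R : realType.
Implicit Types (x y z w : 'rV[R]_6) (h : 'M[R]_4).

Local Notation S := (lam2_form (@vol4 R)).
Local Notation Q := (gram_form S).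
Local Notation dual x := (skew (x *m S)).

(** Rule for the computations that follow: in an alternating product, Q-orthogonal neighbours are
    exchanged at the cost of a sign, while the pattern of duals stays in place. *)
Lemma skew_anti x y : Q x y = 0 -> skew x * dual y = - (skew y * dual x).
Proof.
move=> xy; apply/eqP; rewrite -addr_eq0 -!mulmxE skew_clifford xy.
by rewrite raddf0 oppr0.
Qed.

Lemma dual_anti x y : Q x y = 0 -> dual x * skew y = - (dual y * skew x).
Proof.
move=> xy; apply/eqP; rewrite -addr_eq0 -!mulmxE skew_clifford_dual xy.
by rewrite raddf0 oppr0.
Qed.

Lemma dual_sqr x : dual x * skew x = (- (Q x x / 2))%:M.
Proof.
have := skew_clifford_dual x x.
rewrite mulmxE -mulr2n -scaler_nat => /(congr1 ( *:%R 2^-1)).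
rewrite scalerA mulVf ?pnatr_eq0 // scale1r => ->.
by rewrite -scaleN1r !scale_scalar_mx; congr _%:M; rewrite mulN1r mulrN mulrC.
Qed.

Variables x1 x2 x3 : 'rV[R]_6.
Hypothesis Q12 : Q x1 x2 = 0.
Hypothesis Q13 : Q x1 x3 = 0.
Hypothesis Q23 : Q x2 x3 = 0.
Hypothesis Q11 : 0 < Q x1 x1.
Hypothesis Q22 : 0 < Q x2 x2.
Hypothesis Q33 : 0 < Q x3 x3.

Let Q21 : Q x2 x1 = 0. Proof. by rewrite gram_form_sym ?vol4_gram_sym. Qed.
Let Q31 : Q x3 x1 = 0. Proof. by rewrite gram_form_sym ?vol4_gram_sym. Qed.
Let Q32 : Q x3 x2 = 0. Proof. by rewrite gram_form_sym ?vol4_gram_sym. Qed.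

(** Duals carry lower indices and bivectors upper ones, so this product is a form on vectors and
    [urbantke_dual] is one on covectors. *)
Definition urbantke := dual x1 * skew x2 * dual x3.
Definition urbantke_dual := skew x1 * dual x2 * skew x3.
(** Each of the three bivectors contributes the factor Q(xi, xi) / 2 of [dual_sqr]. *)
Definition urbantke_norm := Q x1 x1 * Q x2 x2 * Q x3 x3 / 8.

(** Transposing three skew factors gives one sign and reverses their order; restoring the order
    takes three exchanges, and the signs cancel. *)
Lemma urbantke_sym : urbantke^T = urbantke.
Proof.
rewrite /urbantke -!mulmxE !trmx_mul !skew_tr !mulmxE !mulNr !mulrN opprK.
rewrite mulrA (dual_anti Q32) mulNr -[dual x2 * _ * _]mulrA (skew_anti Q31).
by rewrite mulrN opprK mulrA (dual_anti Q21) !mulNr opprK.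
Qed.

(** Moving y to the front takes three exchanges; the duals stay in place, which turns [urbantke]
    into [urbantke_dual]. *)
Lemma urbantkeM_orth y : Q x1 y = 0 -> Q x2 y = 0 -> Q x3 y = 0 ->
  urbantke * skew y = - (dual y * urbantke_dual).
Proof.
move=> y1 y2 y3; rewrite /urbantke /urbantke_dual.
rewrite -[LHS]mulrA (dual_anti y3) mulrN !mulrA -[dual x1 * _ * _]mulrA.
by rewrite (skew_anti y2) mulrN mulNr opprK mulrA (dual_anti y1) !mulNr.
Qed.

(** A member of the triple is exchanged only with the two others, so the sign is opposite to that of
    [urbantkeM_orth]. This separates the two eigenspaces of the star. *)
Lemma urbantkeM1 : urbantke * skew x1 = dual x1 * urbantke_dual.
Proof.
rewrite /urbantke /urbantke_dual -[LHS]mulrA (dual_anti Q31) mulrN.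
rewrite [in LHS]mulrA -[dual x1 * _ * _]mulrA (skew_anti Q21).
by rewrite mulrN mulNr opprK !mulrA.
Qed.

Lemma urbantkeM2 : urbantke * skew x2 = dual x2 * urbantke_dual.
Proof.
rewrite /urbantke /urbantke_dual -[LHS]mulrA (dual_anti Q32) mulrN.
by rewrite !mulrA (dual_anti Q21) !mulNr.
Qed.

Lemma urbantkeM3 : urbantke * skew x3 = dual x3 * urbantke_dual.
Proof.
rewrite /urbantke /urbantke_dual [RHS]mulrA [dual x3 * _]mulrA (dual_anti Q31).
rewrite 2!mulNr -[dual x1 * skew x3 * _]mulrA (skew_anti Q32).
by rewrite mulrN mulNr opprK mulrA.
Qed.

(** By [urbantkeM3] the product reduces to the square of X1' X2 times the scalar X3' X3; one more
    exchange leaves only scalars Xi' Xi. *)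
Lemma urbantkeK : urbantke * urbantke_dual = urbantke_norm%:M.
Proof.
have -> : urbantke * urbantke_dual =
    dual x1 * skew x2 * (dual x3 * urbantke_dual).
  by rewrite /urbantke -!mulrA.
have -> : dual x3 * urbantke_dual = dual x1 * skew x2 * (- (Q x3 x3 / 2))%:M.
  by rewrite -urbantkeM3 /urbantke -mulrA dual_sqr.
rewrite mulrA; have -> : dual x1 * skew x2 * (dual x1 * skew x2) =
    - (dual x1 * skew x1 * (dual x2 * skew x2)).
  by rewrite mulrA -[dual x1 * _ * _]mulrA (skew_anti Q21) mulrN mulNr !mulrA.
rewrite !dual_sqr -!mulmxE -!scalar_mxM -rmorphN -scalar_mxM /urbantke_norm.
by congr _%:M; field.
Qed.

Lemma urbantke_dualK : urbantke_dual * urbantke = urbantke_norm%:M.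
Proof.
have n0 : urbantke_norm != 0 by rewrite gt_eqF // divr_gt0 // !mulr_gt0.
have := urbantkeK; rewrite -!mulmxE => hk.
have /mulmx1C : urbantke *m (urbantke_norm^-1 *: urbantke_dual) = 1%:M.
  by rewrite -scalemxAr hk scale_scalar_mx mulVf.
rewrite -scalemxAl => /(congr1 ( *:%R urbantke_norm)).
by rewrite scalerA mulfV // scale1r scale_scalar_mx mulr1.
Qed.

(* If v is isotropic, then v X1', v X2', v X3' and v h all annihilate v, hence
   are dependent: v (Z' + e h) = 0 with Z a combination of the Xi.  But
   (Z' + e h) (e k - Z) is a positive scalar, where k is the dual of h. *)
Lemma urbantke_anisotropic (v : 'rV_4) : v != 0 -> gram_form urbantke v v != 0.
Proof.
move=> v0; apply/eqP => vhv.
pose M := \matrix_(i < 4) nth 0 [:: v *m dual x1; v *m dual x2; v *m dual x3;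
   v *m urbantke] i.
have vXv x : v *m skew x *m v^T = 0.
  apply/matrixP => i j; rewrite !ord1 [RHS]mxE.
  have : v *m skew x *m v^T = - (v *m skew x *m v^T)^T.
    by rewrite !trmx_mul trmxK skew_tr mulNmx mulmxN opprK mulmxA.
  by move=> /matrixP/(_ 0 0); rewrite [RHS]mxE [X in - X]mxE; lra.
have Mv : M *m v^T = 0.
  apply/row_matrixP => i; rewrite row_mul rowK row0.
  case: i => [[|[|[|[|//]]]] ?] /=; rewrite ?vXv //.
  by apply/matrixP => k l; rewrite !ord1 [RHS]mxE.
have /det0P[c c0 cM] : \det M == 0.
  apply: contraNT v0 => M0; rewrite -trmx_eq0 -(mulKmx (_ : M \in unitmx) v^T).
    by rewrite Mv mulmx0.
  by rewrite unitmxE unitfE.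
pose z := c 0 0 *: x1 + c 0 1 *: x2 + c 0 2 *: x3.
have vz : v *m (dual z + c 0 3 *: urbantke) = 0.
  move: cM; rewrite mulmx_sum_row big_ord4 !rowK /= => <-.
  by rewrite /z !mulmxDl -!scalemxAl !linearD !linearZ /=.
have hz : urbantke * skew z = dual z * urbantke_dual.
  rewrite /z !mulmxDl !linearD -!scalemxAl !linearZ /= !mulrDr !mulrDl.
  by rewrite -!scalerAl -!scalerAr urbantkeM1 urbantkeM2 urbantkeM3.
have Qz : Q z z =
    c 0 0 ^+ 2 * Q x1 x1 + c 0 1 ^+ 2 * Q x2 x2 + c 0 2 ^+ 2 * Q x3 x3.
  rewrite /z -!addrA -[c 0 2 *: x3]addr0 !(gram_form_linl, gram_form_linr).
  rewrite Q12 Q13 Q23 Q21 Q31 Q32.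
  have Q0l w : Q 0 w = 0 by rewrite /gram_form !mul0mx mxE.
  have Q0r w : Q w 0 = 0 by rewrite /gram_form trmx0 mulmx0 mxE.
  by rewrite !Q0l !Q0r; ring.
(* The cross terms cancel by [hz]; the outer terms are scalars by [urbantkeK] and [dual_sqr]. *)
have prod t : t = c 0 3 ^+ 2 * urbantke_norm + Q z z / 2 ->
    (dual z + c 0 3 *: urbantke) * (c 0 3 *: urbantke_dual - skew z) = t%:M.
  move=> tE; rewrite mulrDl !mulrBr -!scalerAl -!scalerAr urbantkeK hz dual_sqr.
  move: (dual z * urbantke_dual) => T; apply/matrixP => i j.
  by rewrite !mxE tE; case: (i == j); rewrite ?mulr1n ?mulr0n; ring.
have /eqP := congr1 (mulmx^~ (c 0 3 *: urbantke_dual - skew z)) vz.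
rewrite /= mul0mx -mulmxA mulmxE (prod _ erefl) mul_mx_scalar scaler_eq0.
rewrite (negPf v0) orbF.
have n0 : 0 < urbantke_norm by rewrite divr_gt0 // !mulr_gt0.
rewrite Qz => /eqP.
have ge0 i a : 0 < a -> 0 <= c 0 i ^+ 2 * a.
  by move=> /ltW; exact/mulr_ge0/sqr_ge0.
have eq0 i a : 0 < a -> c 0 i ^+ 2 * a = 0 -> c 0 i = 0.
  by move=> a0 /eqP; rewrite mulf_eq0 (gt_eqF a0) orbF sqrf_eq0 => /eqP.
have t0 := ge0 0 _ Q11; have t1 := ge0 1 _ Q22.
have t2 := ge0 2 _ Q33; have t3 := ge0 3 _ n0.
move=> sum0; move/eqP: c0; apply; apply/rowP => i; rewrite [RHS]mxE.
case: i => [[|[|[|[|//]]]] ?]; set k := Ordinal _.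
- by have -> : k = 0; [exact/val_inj | apply: (eq0 _ _ Q11); lra].
- by have -> : k = 1; [exact/val_inj | apply: (eq0 _ _ Q22); lra].
- by have -> : k = 2; [exact/val_inj | apply: (eq0 _ _ Q33); lra].
- by have -> : k = 3; [exact/val_inj | apply: (eq0 _ _ n0); lra].
Qed.

(** A real symmetric form without isotropic vectors is definite, and its value at [ebase 0] supplies
    the sign that makes it positive. *)
Lemma urbantke_definite :
  inner_product (gram_form urbantke (ebase 0) (ebase 0) *: urbantke).
Proof.
set a := gram_form _ _ _.
have gZ u v : gram_form (a *: urbantke) u v = a * gram_form urbantke u v.
  by rewrite /gram_form -scalemxAr -scalemxAl mxE.
have gC := gram_form_sym urbantke_sym.
have e0 : ebase 0 != 0 :> 'rV[R]_4.
  by apply/eqP => /rowP/(_ 0)/eqP; rewrite !mxE oner_eq0.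
have a0 : a != 0 := urbantke_anisotropic e0.
split=> [u v|v v0]; rewrite !gZ ?(gC u v) //.
set b := gram_form urbantke v v; set m := gram_form urbantke (ebase 0) v.
have b0 : b != 0 := urbantke_anisotropic v0.
rewrite lt_neqAle eq_sym mulf_neq0 //= leNgt; apply/negP => ab.
(* A root of b t^2 + 2 m t + a, the value of the form at t v + e_0; it is real because a b < 0.
   Anisotropy then makes e_0 a multiple of v, so that a and b cannot have opposite signs. *)
pose t := (Num.sqrt (m ^+ 2 - a * b) - m) / b.
have tP : gram_form urbantke (t *: v + ebase 0) (t *: v + ebase 0) = 0.
  rewrite gram_form_linl !gram_form_linr -/b -/a (gC v) -/m.
  have sq : Num.sqrt (m ^+ 2 - a * b) ^+ 2 = m ^+ 2 - a * b.
    by rewrite sqr_sqrtr // subr_ge0 (le_trans (ltW ab)) ?sqr_ge0.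
  have -> : t * (t * b + m) + (t * m + a) =
     (Num.sqrt (m ^+ 2 - a * b) ^+ 2 - m ^+ 2) / b + a by rewrite /t; field.
  by rewrite sq; field.
have : t *: v + ebase 0 = 0.
  by apply: contra_eq tP; exact: urbantke_anisotropic.
move=> /eqP; rewrite addrC addr_eq0 => /eqP et.
have : a = t ^+ 2 * b.
  rewrite /a et /gram_form linearN /= mulmxN !mulNmx opprK linearZ /=.
  by rewrite -scalemxAr -!scalemxAl scalerA mxE.
move=> at2; move: ab; rewrite at2 -mulrA -expr2 ltNge.
by rewrite mulr_ge0 ?sqr_ge0.
Qed.

(** Multiplying the hypothesis by [urbantke] on the right gives h X h = e n X' with h = [urbantke]
    and n = [urbantke_norm]. So the induced form sends x to a multiple of its dual, and S leads back
    to x. *)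
Lemma urbantke_eigen s x e :
  urbantke * skew x = e *: (dual x * urbantke_dual) ->
  exists c, x *m hodge (s *: urbantke) = c *: x.
Proof.
move=> hx; have h_sym : (s *: urbantke)^T = s *: urbantke.
  by rewrite linearZ /= urbantke_sym.
suff -> : hodge (s *: urbantke) =
    dvol (s *: urbantke) *: (lam2_inner (s *: urbantke) *m S).
  move: (dvol _) => d; exists (d * (s ^+ 2 * (e * urbantke_norm))).
  rewrite -scalemxAr -scalerA; congr (_ *: _); rewrite mulmxA.
  have -> : x *m lam2_inner (s *: urbantke) =
      (s ^+ 2 * (e * urbantke_norm)) *: (x *m S).
    apply: skew_inj; rewrite skew_lam2_inner // [RHS]linearZ /=.
    rewrite -!scalemxAl -scalemxAr scalerA -expr2 -[in RHS]scalerA.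
    congr (_ *: _).
    rewrite !mulmxE hx -scalerAl -mulrA urbantke_dualK -!mulmxE mul_mx_scalar.
    by rewrite scalerA.
  by rewrite -scalemxAl -mulmxA vol4_gramV mulmx1.
exact: hodgeE.
Qed.

End Urbantke.

(** * Signature of the wedge pairing, and construction of h from an eigenbasis *)

Section PositiveTriple.
Variable R : realType.
Local Notation S := (lam2_form (@vol4 R)).
Local Notation Q := (gram_form S).

Lemma wedge_sqr0 (w : 'rV[R]_6) :
  w 0 3 = 0 -> w 0 4 = 0 -> w 0 5 = 0 -> Q w w = 0.
Proof.
move=> w3 w4 w5; rewrite /gram_form wedge_dualE mxE big_ord6 !mxE /= w3 w4 w5.
by ring.
Qed.

(* The bivectors e_0 /\ e_i span a Q-isotropic 3-space, which meets every
   negative definite subspace trivially. *)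
Lemma wedge_negative_card (V : 'M[R]_6) (q : 'rV_6) :
  V *m S *m V^T = diag_mx q ->
  (#|[set i | (q 0 i < 0)%R]| <= 3)%N.
Proof.
move=> VSV; set N := [set i | _]; rewrite leqNgt; apply/negP => N3.
have f_inj := @enum_val_inj _ (mem N).
set f : 'I_#|N| -> 'I_6 := enum_val in f_inj; pose M := rowsub f V.
have MSM : M *m S *m M^T = diag_mx (\row_i q 0 (f i)).
  apply/matrixP => i j; rewrite -gram_form_row !row_rowsub gram_form_row VSV.
  by rewrite !mxE (inj_eq f_inj).
(* The last three coordinates are those of the e_i /\ e_j without e_0. More than three rows admit a
   nontrivial combination on which these three vanish. *)
pose g (j : 'I_3) : 'I_6 := rshift 3 j.
have /rowV0Pn[c /sub_kermxP cMg c0] : kermx (colsub g M) != 0.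
  rewrite kermx_eq0 /row_free ltn_eqF // (leq_ltn_trans _ N3) //.
  exact: rank_leq_col.
have cM0 (j : 'I_3) : (c *m M) 0 (g j) = 0.
  by move: cMg; rewrite mulmx_colsub => /matrixP/(_ 0 j); rewrite !mxE.
have : Q (c *m M) (c *m M) = 0.
  by apply: wedge_sqr0; [rewrite -(cM0 0)|rewrite -(cM0 1)|rewrite -(cM0 2)];
    congr ((c *m M) _ _); apply/val_inj.
have -> : Q (c *m M) (c *m M) = \sum_i c 0 i ^+ 2 * q 0 (f i).
  rewrite /gram_form trmx_mul !mulmxA -[c *m M *m S]mulmxA.
  rewrite -[c *m _ *m M^T]mulmxA MSM mxE.
  by apply: eq_bigr => i _; rewrite mul_mx_diag !mxE; ring.
have qf i : q 0 (f i) < 0 by have := enum_valP i; rewrite inE.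
have t0 i : 0 <= c 0 i ^+ 2 * - q 0 (f i).
  by rewrite mulr_ge0 ?sqr_ge0 // oppr_ge0 ltW.
move=> /eqP; rewrite -oppr_eq0 -sumrN.
under eq_bigr do rewrite -mulrN.
rewrite psumr_eq0 // => /allP cq0; move/eqP: c0; apply; apply/rowP => i.
have := cq0 i (mem_index_enum _).
rewrite mulf_eq0 oppr_eq0 (lt_eqF (qf i)) orbF.
by rewrite sqrf_eq0 mxE => /eqP.
Qed.

Lemma diagonalizable_comm_hodge (A : 'M[R]_6) : A *m S = S *m A^T ->
  diagonalizable A -> exists h, inner_product h /\ comm_mx A (hodge h).
Proof.
move=> AS [P P_unit /mxred.similar_diagPex[D /(mxred.similarP P_unit) PA]].
have [V [d [q [V_unit [VA VSV q0]]]]] :=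
  orthogonal_eigenbasis vol4_gram_sym vol4_unit AS P_unit PA.
have QV i j : Q (row i V) (row j V) = q 0 i *+ (i == j).
  by rewrite gram_form_row VSV mxE.
(* None of the six [q 0 i] is zero and at most three are negative. *)
have : (2 < #|[set i | (0 < q 0 i)%R]|)%N.
  have := wedge_negative_card VSV; set N := [set i | _] => N3.
  have -> : [set i | 0 < q 0 i] = ~: N.
    by apply/setP => i; rewrite !inE lt_neqAle eq_sym q0 leNgt.
  by have := cardsC N; rewrite card_ord; lia.
case/card_gt2P => i1 [i2 [i3 [[]]]]; rewrite !inE => p1 p2 p3 [n12 n23 n31].
pose x i := row i V.
have Q0 i j : i != j -> Q (x i) (x j) = 0 by move=> /negPf ij; rewrite QV ij.
have Qp i : 0 < q 0 i -> 0 < Q (x i) (x i) by rewrite QV eqxx.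
have Q12 := Q0 _ _ n12; have Q23 := Q0 _ _ n23.
have Q13 : Q (x i1) (x i3) = 0 by apply: Q0; rewrite eq_sym.
have h_inner := urbantke_definite Q12 Q13 Q23 (Qp _ p1) (Qp _ p2) (Qp _ p3).
move: h_inner; set s := gram_form _ _ _ => h_inner.
eexists; split; first exact: h_inner.
have urbantke_eig := urbantke_eigen Q12 Q13 Q23 (Qp _ p1) (Qp _ p2) (Qp _ p3) s.
have eig i : exists c,
    x i *m hodge (s *: urbantke (x i1) (x i2) (x i3)) = c *: x i.
  have [->|ni1] := eqVneq i i1.
    by apply: (urbantke_eig _ 1); rewrite scale1r urbantkeM1.
  have [->|ni2] := eqVneq i i2.
    by apply: (urbantke_eig _ 1); rewrite scale1r urbantkeM2.
  have [->|ni3] := eqVneq i i3.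
    by apply: (urbantke_eig _ 1); rewrite scale1r urbantkeM3.
  apply: (urbantke_eig _ (-1)).
  by rewrite scaleN1r urbantkeM_orth // Q0 // eq_sym.
move: (hodge _) eig => H eig.
(* A and the star are both diagonal in the basis V, hence commute. *)
have [c VH] : exists c, V *m H = diag_mx c *m V.
  exists (\row_i sval (cid (eig i))); apply/row_matrixP => i.
  rewrite !row_mul row_diag_mx -scalemxAl -rowE mxE; exact: svalP (cid (eig i)).
rewrite /comm_mx -[LHS](mulKmx V_unit) -[RHS](mulKmx V_unit); congr (_ *m _).
by rewrite !mulmxA VA VH -!mulmxA VA VH !mulmxA diag_mxC.
Qed.

End PositiveTriple.

(** * Symmetry of the curvature tensor *)

Section SymmetryOfMixedDerivatives.
Variables (R : realType) (V : normedModType R).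
Implicit Types (f : V -> R) (x u v w : V).

Lemma is_derive_line f u w (t : R) : derivable f (t *: u + w) u ->
  is_derive t 1 (fun r : R => f (r *: u + w)) ('D_u f (t *: u + w)).
Proof.
have E : (fun h : R => h^-1 *:
      (((fun r : R => f (r *: u + w)) \o shift t) (h *: 1) - f (t *: u + w))) =
    (fun h : R => h^-1 *:
      ((f \o shift (t *: u + w)) (h *: u) - f (t *: u + w))).
  by apply/funext => h /=; rewrite [h *: 1]mulr1 scalerDl addrA.
by move=> df; split; rewrite /derivable /derive E.
Qed.

Lemma MVT_line f u w (s : R) : 0 < s ->
  (forall t, 0 <= t <= s -> derivable f (t *: u + w) u) ->
  exists2 t, 0 <= t <= s &
    f (s *: u + w) - f w = s * 'D_u f (t *: u + w).
Proof.
move=> s0 df.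
have dline t : 0 <= t <= s -> _ := fun ts => is_derive_line (df t ts).
have [t||t tI ft] := @MVT R (fun r => f (r *: u + w))
   (fun r => 'D_u f (r *: u + w)) 0 s s0.
- by rewrite in_itv /= => /andP[t0 ts]; apply: dline; rewrite !ltW.
- apply: derivable_within_continuous => t; rewrite in_itv /= => ts.
  by have [] := dline t ts.
exists t; first by move: tI; rewrite in_itv /= => /andP[t0 ts]; rewrite !ltW.
by move: ft; rewrite scale0r add0r subr0 mulrC.
Qed.

(** The mean value theorem is used twice: along u for [phi], the increment of f in direction v, then
    along v for ['D_u f]. *)
Lemma second_difference f x u v (s : R) : 0 < s ->
  (forall a b, 0 <= a <= s -> 0 <= b <= s ->
    derivable f (a *: u + (b *: v + x)) u /\
    derivable ('D_u f) (a *: u + (b *: v + x)) v) ->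
  exists a b, [/\ 0 <= a <= s, 0 <= b <= s &
    f (s *: u + (s *: v + x)) - f (s *: u + x) - f (s *: v + x) + f x =
    s ^+ 2 * 'D_v ('D_u f) (a *: u + (b *: v + x))].
Proof.
move=> s0 df; have ss : 0 <= s <= s by rewrite lexx ltW.
have s00 : 0 <= (0 : R) <= s by rewrite lexx ltW.
pose phi (r : R) := f (r *: u + (s *: v + x)) - f (r *: u + x).
pose dphi (r : R) := 'D_u f (r *: u + (s *: v + x)) - 'D_u f (r *: u + x).
have phi_derive (a : R) : 0 <= a <= s -> is_derive a 1 phi (dphi a).
  move=> as_; have [d1 _] := df a s as_ ss.
  have [d0 _] := df a 0 as_ s00; rewrite scale0r add0r in d0.
  exact: is_deriveB (is_derive_line d1) (is_derive_line d0).
have [a||a aI phia] := @MVT R phi dphi 0 s s0.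
- by rewrite in_itv /= => /andP[a0 as_]; apply: phi_derive; rewrite !ltW.
- apply: derivable_within_continuous => a; rewrite in_itv /= => as_.
  by have [] := phi_derive a as_.
have {}aI : 0 <= a <= s.
  by move: aI; rewrite in_itv /= => /andP[? ?]; rewrite !ltW.
have [|b bI db] := @MVT_line ('D_u f) v (a *: u + x) s s0.
  by move=> b bI; rewrite addrCA; have [] := df a b aI bI.
have swap (c e : R) : c *: v + (e *: u + x) = e *: u + (c *: v + x).
  exact: addrCA.
rewrite !swap in db; rewrite /phi /dphi !scale0r !add0r subr0 in phia.
exists a, b; split; [exact: aI | exact: bI |].
rewrite expr2 -[RHS]mulrA -db [RHS]mulrC -phia.
by rewrite opprB [RHS]addrA [RHS]addrAC.
Qed.

(** The second difference is symmetric in u and v, so the two mixed derivatives take a common value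
    at points arbitrarily close to x; continuity does the rest. *)
Lemma mixed_derivative_sym f x u v :
  (\forall y \near x, [/\ derivable f y u, derivable f y v,
     derivable ('D_u f) y v & derivable ('D_v f) y u]) ->
  {for x, continuous ('D_v ('D_u f))} -> {for x, continuous ('D_u ('D_v f))} ->
  'D_v ('D_u f) x = 'D_u ('D_v f) x.
Proof.
move=> fd cvu cuv; apply/eqP; rewrite -subr_eq0 -normr_le0.
apply/ler_addgt0Pl => e e0; rewrite addr0.
have e2 : 0 < e / 2 by rewrite divr_gt0.
have close_limits (A B C D : R) :
    `|A - C| < e / 2 -> `|B - D| < e / 2 -> C = D -> `|A - B| <= e.
  move=> AC BD CD; rewrite -(subrKA C) (le_trans (ler_normD _ _)) //.
  by rewrite (splitr e) lerD ?(ltW AC) // distrC CD ltW.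
have c1 : \forall y \near x, `|'D_v ('D_u f) x - 'D_v ('D_u f) y| < e / 2.
  by have /cvgrPdist_lt/(_ _ e2) := cvu.
have c2 : \forall y \near x, `|'D_u ('D_v f) x - 'D_u ('D_v f) y| < e / 2.
  by have /cvgrPdist_lt/(_ _ e2) := cuv.
have : \forall y \near x, [/\ [/\ derivable f y u, derivable f y v,
     derivable ('D_u f) y v & derivable ('D_v f) y u],
     `|'D_v ('D_u f) x - 'D_v ('D_u f) y| < e / 2 &
     `|'D_u ('D_v f) x - 'D_u ('D_v f) y| < e / 2].
  by apply: filterS3 fd c1 c2 => y.
case/nbhs_ballP => d d0 fy.
(* With this s the parallelogram spanned by s u and s v at x stays within distance s n = d / 2 of x;
   the summand 1 keeps n positive. *)
pose n := `|u| + `|v| + 1; pose s := d / 2 / n.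
have n0 : 0 < n by rewrite ltr_wpDl ?addr_ge0.
have s0 : 0 < s by rewrite !divr_gt0.
have near_x a b : 0 <= a <= s -> 0 <= b <= s ->
    ball x d (a *: u + (b *: v + x)).
  move=> /andP[a0 as_] /andP[b0 bs]; rewrite -ball_normE /ball_ /=.
  rewrite addrA opprD addrCA subrr addr0 normrN.
  rewrite (le_lt_trans (ler_normD _ _)) // !normrZ !ger0_norm //.
  apply: (@le_lt_trans _ _ (s * n)).
    rewrite /n !mulrDr mulr1 -addrA lerD ?ler_wpM2r // ler_wpDr ?ler_wpM2r //.
    exact: ltW.
  by rewrite /s divfK ?gt_eqF // ltr_pdivrMr // ltr_pMr // ltr1n.
have [a b aI bI|a [b [aI bI vu]]] := @second_difference f x u v s s0.
  by have [[]] := fy _ (near_x a b aI bI).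
have near_x' c e' : 0 <= c <= s -> 0 <= e' <= s ->
    ball x d (c *: v + (e' *: u + x)).
  by move=> cI eI; rewrite addrCA; exact: near_x.
have [a' b' aI' bI'|a' [b' [aI' bI' uv]]] := @second_difference f x v u s s0.
  by have [[]] := fy _ (near_x' a' b' aI' bI').
have E : 'D_v ('D_u f) (a *: u + (b *: v + x)) =
    'D_u ('D_v f) (a' *: v + (b' *: u + x)).
  apply: (@mulfI _ (s ^+ 2)); first by rewrite expf_neq0 ?gt_eqF.
  have swap : s *: v + (s *: u + x) = s *: u + (s *: v + x) by exact: addrCA.
  rewrite swap in uv; rewrite -[LHS]vu -[RHS]uv.
  move: (f (s *: u + (s *: v + x))) (f (s *: u + x)) (f (s *: v + x)).
  by move=> A B C; ring.
have [_ vuy _] := fy _ (near_x a b aI bI).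
have [_ _ uvy] := fy _ (near_x' a' b' aI' bI').
exact: close_limits vuy uvy E.
Qed.

End SymmetryOfMixedDerivatives.

(** * Derivability of determinants and inverse matrices *)

Section Derivability.
Variables (R : realType) (V : normedModType R).
Implicit Types (x v : V).

Lemma derivable_bigsum (I : Type) (r : seq I) (P : pred I) (F : I -> V -> R)
    x v :
  (forall i, P i -> derivable (F i) x v) ->
  derivable (fun y => \sum_(i <- r | P i) F i y) x v.
Proof.
move=> dF; rewrite -fct_sumE.
by elim/big_ind: _ => [|f h df dh|i Pi];
  [exact: derivable_cst | exact: derivableD | exact: dF].
Qed.

Lemma derivable_bigprod (I : Type) (r : seq I) (P : pred I) (F : I -> V -> R)
    x v :
  (forall i, P i -> derivable (F i) x v) ->
  derivable (fun y => \prod_(i <- r | P i) F i y) x v.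
Proof.
move=> dF; rewrite -fct_prodE.
by elim/big_ind: _ => [|f h df dh|i Pi];
  [exact: derivable_cst | exact: derivableM | exact: dF].
Qed.

Lemma derivable_det n (M : V -> 'M[R]_n) x v :
  (forall i j, derivable (fun y => M y i j) x v) ->
  derivable (fun y => \det (M y)) x v.
Proof.
move=> dM; apply: derivable_bigsum => s _.
by apply: derivableM (derivable_cst _ _ _) _; exact: derivable_bigprod.
Qed.

(** Cramer's formula describes [invmx] on invertible matrices, so invertibility is assumed on a
    neighbourhood of x. *)
Lemma derivable_invmx n (M : V -> 'M[R]_n) x v i j :
  (\forall y \near x, M y \in unitmx) ->
  (forall i j, derivable (fun y => M y i j) x v) ->
  derivable (fun y => invmx (M y) i j) x v.
Proof.
move=> Mu dM.
apply: (@near_eq_derivable _ _ _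
  (fun y => (\det (M y))^-1 * cofactor (M y) j i)).
  by apply: filterS Mu => y yu; rewrite /invmx yu !mxE.
apply: derivableM.
  apply: derivableV; last exact: derivable_det.
  by have := nbhs_singleton Mu; rewrite unitmxE unitfE.
apply: derivableM (derivable_cst _ _ _) _; apply: derivable_det => k l.
by under eq_fun do rewrite !mxE; exact: dM.
Qed.

Lemma derive_bigsum n (F : 'I_n -> V -> R) x v :
  (forall i, derivable (F i) x v) ->
  'D_v (fun y => \sum_i F i y) x = \sum_i 'D_v (F i) x.
Proof.
by move=> dF; rewrite -fct_sumE derive_sum.
Qed.

End Derivability.

(** * Pair symmetry of the Riemann tensor in coordinates *)

Section CurvatureSymmetry.
Variable R : realType.
Local Notation E := 'rV[R]_4.
Variables (g : E -> 'M[R]_4) (U : set E).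
Hypothesis U_open : open U.
Hypothesis g_smooth : forall i j, smooth_on U (fun y => g y i j).
Hypothesis g_inner : forall y, U y -> inner_product (g y).

Local Notation dg l i j := (partial l (fun y => g y i j)).

(* Christoffel symbols of the first kind, Gamma_{d,bc}. *)
Definition christoffel1 (d b c : 'I_4) (x : E) : R :=
  2^-1 * (dg b c d x + dg c b d x - dg d b c x).

Lemma near_U x : U x -> \forall y \near x, U y.
Proof. by move=> Ux; exact: open_nbhs_nbhs. Qed.

Lemma metric_sym x i j : U x -> g x i j = g x j i.
Proof. by move=> Ux; rewrite -{1}(inner_product_sym (g_inner Ux)) mxE. Qed.

Lemma dmetric_sym x l i j : U x -> dg l i j x = dg l j i x.
Proof.
move=> Ux; apply: near_eq_derive; apply: filterS (near_U Ux) => y Uy.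
exact: metric_sym.
Qed.

Lemma ddmetric_sym x k l i j : U x ->
  partial k (dg l i j) x = partial k (dg l j i) x.
Proof.
move=> Ux; apply: near_eq_derive; apply: filterS (near_U Ux) => y Uy.
exact: dmetric_sym.
Qed.

Lemma metric_derivable x i j l : U x ->
  derivable (fun y => g y i j) x (ebase l).
Proof. by move=> Ux; have [_] := g_smooth i j [::] Ux; exact. Qed.

Lemma dmetric_derivable x i j k l : U x -> derivable (dg l i j) x (ebase k).
Proof. by move=> Ux; have [_] := g_smooth i j [:: l] Ux; exact. Qed.

Lemma ddmetric_swap x k l i j : U x ->
  partial k (dg l i j) x = partial l (dg k i j) x.
Proof.
move=> Ux; apply: mixed_derivative_sym.
- apply: filterS (near_U Ux) => y Uy.
  by split; [exact: metric_derivable | exact: metric_derivable |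
             exact: dmetric_derivable | exact: dmetric_derivable].
- by have [] := g_smooth i j [:: k; l] Ux.
- by have [] := g_smooth i j [:: l; k] Ux.
Qed.

Lemma metric_unit x : U x -> g x \in unitmx.
Proof.
by move=> Ux; rewrite unitmxE unitfE; exact/inner_product_det_neq0/g_inner.
Qed.

Lemma christoffel_derivable x k i j l : U x ->
  derivable (christoffel g k i j) x (ebase l).
Proof.
move=> Ux; apply: derivableM (derivable_cst _ _ _) _.
apply: derivable_bigsum => m _; apply: derivableM.
  apply: derivable_invmx => [|a b]; last exact: metric_derivable.
  by apply: filterS (near_U Ux) => y; exact: metric_unit.
apply: derivableB; last exact: dmetric_derivable.
by apply: derivableD; exact: dmetric_derivable.
Qed.

Lemma lower_christoffel x d b c : U x ->
  \sum_k g x d k * christoffel g k b c x = christoffel1 d b c x.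
Proof.
move=> Ux; pose w := \col_l (dg b c l x + dg c b l x - dg l b c x).
have -> : \sum_k g x d k * christoffel g k b c x =
    2^-1 * (g x *m (invmx (g x) *m w)) d 0.
  rewrite mxE mulr_sumr; apply: eq_bigr => k _; rewrite mulrCA.
  congr (_ * (_ * _)).
  by rewrite mxE; apply: eq_bigr => l _; rewrite mxE.
by rewrite mulKVmx ?metric_unit // mxE.
Qed.

Lemma christoffel_sym x k i j : U x ->
  christoffel g k i j x = christoffel g k j i x.
Proof.
move=> Ux; congr (_ * _); apply: eq_bigr => l _.
by rewrite (dmetric_sym l i j Ux) [X in _ * (X - _)]addrC.
Qed.

(** Metric compatibility of the Levi-Civita connection. *)
Lemma christoffel1_metric x a d k : U x ->
  dg a d k x = christoffel1 d a k x + christoffel1 k a d x.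
Proof.
move=> Ux; rewrite /christoffel1 (dmetric_sym a k d Ux).
by field.
Qed.

(** The g-product of the vectors Gamma_{ab} and Gamma_{cd}, with one index already lowered: the
    quadratic part of the curvature. *)
Definition christoffel_pairing (a b c d : 'I_4) x : R :=
  \sum_k christoffel1 k a b x * christoffel g k c d x.

Lemma christoffel_pairing_sym x a b c d : U x ->
  christoffel_pairing a b c d x = christoffel_pairing c d a b x.
Proof.
move=> Ux; rewrite /christoffel_pairing.
have E a' b' c' d' : \sum_k christoffel1 k a' b' x * christoffel g k c' d' x =
   \sum_k \sum_l g x k l * christoffel g l a' b' x * christoffel g k c' d' x.
  by apply: eq_bigr => k _; rewrite -lower_christoffel // mulr_suml.
rewrite !E exchange_big /=; apply: eq_bigr => k _; apply: eq_bigr => l _.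
by rewrite metric_sym // mulrAC.
Qed.

Lemma partial_christoffel1 x a d b c : U x -> partial a (christoffel1 d b c) x =
  2^-1 * (partial a (dg b c d) x + partial a (dg c b d) x
          - partial a (dg d b c) x).
Proof.
move=> Ux; have dd l i j : derivable (dg l i j) x (ebase a).
  exact: dmetric_derivable.
have dD l i j l' i' j' :
    derivable (fun y => dg l i j y + dg l' i' j' y) x (ebase a).
  by apply: derivableD; exact: dd.
have dB : derivable (fun y => dg b c d y + dg c b d y - dg d b c y) x (ebase a).
  by apply: derivableB; [exact: dD | exact: dd].
rewrite [LHS](deriveMl 2^-1 dB); congr (_ * _).
rewrite [LHS](deriveB (dD _ _ _ _ _ _) (dd _ _ _)).
by rewrite [X in X - _](deriveD (dd _ _ _) (dd _ _ _)).
Qed.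

(** Product rule applied to [lower_christoffel]. *)
Lemma lower_partial_christoffel x a d b c : U x ->
  \sum_k g x d k * partial a (christoffel g k b c) x =
  partial a (christoffel1 d b c) x - \sum_k dg a d k x * christoffel g k b c x.
Proof.
move=> Ux.
have -> : partial a (christoffel1 d b c) x =
    partial a (fun y => \sum_k g y d k * christoffel g k b c y) x.
  apply: near_eq_derive; apply: filterS (near_U Ux) => y Uy.
  by rewrite lower_christoffel.
rewrite /partial derive_bigsum => [|k]; last first.
  apply: derivableM; first exact: metric_derivable.
  exact: christoffel_derivable.
rewrite -sumrB; apply: eq_bigr => k _.
rewrite (deriveM (metric_derivable (i := d) (j := k) (l := a) Ux)
  (christoffel_derivable (k := k) (i := b) (j := c) (l := a) Ux)).
by rewrite [X in _ + X - _]mulrC addrK.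
Qed.

Lemma covariant_basis a c : covariant g (fun=> ebase a) (fun=> ebase c) =
  fun y => \row_k christoffel g k a c y.
Proof.
apply/funext => y; rewrite /covariant derive_cst add0r; apply/rowP => k.
rewrite !mxE (bigD1 a) //= (bigD1 c) //= !mxE !eqxx !mulr1.
rewrite !big1 ?addr0 // => [i /negPf ia|j /negPf jc].
  by rewrite big1 // => j _; rewrite !mxE ia andbF mulr0 mul0r.
by rewrite !mxE jc andbF mulr0.
Qed.

Lemma covariant_christoffel x a b c : U x ->
  covariant g (fun=> ebase a) (fun y => \row_k christoffel g k b c y) x =
  \row_k (partial a (christoffel g k b c) x +
     \sum_m christoffel g k a m x * christoffel g m b c x).
Proof.
move=> Ux.
have dG : derivable (fun y => \row_k christoffel g k b c y) x (ebase a).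
  apply/derivable_mxP => i k.
  by under eq_fun do rewrite mxE; exact: christoffel_derivable.
rewrite /covariant derive_mx //; apply/rowP => k; rewrite !mxE; congr (_ + _).
  by congr ('D_(ebase a) _ x); apply/funext => y; rewrite mxE.
rewrite (bigD1 a) //= [X in _ + X]big1 ?addr0 => [|i /negPf ia].
  by apply: eq_bigr => m _; rewrite !mxE !eqxx mulr1.
by rewrite big1 // => m _; rewrite !mxE ia andbF mulr0 mul0r.
Qed.

Lemma riem_basis x a b c d : U x ->
  riem g x (ebase a) (ebase b) (ebase c) (ebase d) =
  partial a (christoffel1 d b c) x - partial b (christoffel1 d a c) x
  - christoffel_pairing a d b c x + christoffel_pairing b d a c x.
Proof.
move=> Ux.
rewrite /riem /riem_fields !covariant_basis !covariant_christoffel //.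
have -> : lie_bracket (fun=> ebase a) (fun=> ebase b) = fun=> 0 :> E.
  by apply/funext => y; rewrite /lie_bracket !derive_cst subrr.
have -> : covariant g (fun=> 0) (fun=> ebase c) x = 0.
  rewrite /covariant derive_cst add0r; apply/rowP => k; rewrite !mxE.
  by rewrite big1 // => i _; rewrite big1 // => j _; rewrite mxE mulr0 mul0r.
have lower (A B : 'I_4 -> R) :
    gram_form (g x) (\row_k A k - \row_k B k) (ebase d) =
    \sum_k g x d k * A k - \sum_k g x d k * B k.
  rewrite gram_formE -sumrB; apply: eq_bigr => k _; rewrite !mxE (bigD1 d) //=.
  rewrite big1 => [|i /negPf id]; last by rewrite mxE id andbF mulr0.
  by rewrite mxE !eqxx mulr1 addr0 metric_sym // mulrC mulrBr.
rewrite subr0 lower.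
(* Lowering the index under the derivative costs a derivative of g. By [christoffel1_metric] it
   splits in two: one part cancels the quadratic term, the other is the pairing. *)
have half a' b' : \sum_k g x d k * (partial a' (christoffel g k b' c) x +
      \sum_m christoffel g k a' m x * christoffel g m b' c x) =
    partial a' (christoffel1 d b' c) x - christoffel_pairing a' d b' c x.
  under eq_bigr do rewrite mulrDr.
  rewrite big_split /= lower_partial_christoffel //.
  rewrite -addrA; congr (_ + _).
  have -> : \sum_k g x d k *
        (\sum_m christoffel g k a' m x * christoffel g m b' c x) =
      \sum_m christoffel1 d a' m x * christoffel g m b' c x.
    under eq_bigr do rewrite mulr_sumr.
    rewrite exchange_big /=; apply: eq_bigr => m _.
    rewrite -lower_christoffel // mulr_suml; apply: eq_bigr => k _.
    by rewrite mulrA.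
  rewrite -sumrN -big_split -sumrN /=; apply: eq_bigr => k _.
  by rewrite christoffel1_metric //; ring.
have regroup (A B C D : R) : A - B - (C - D) = A - C - B + D by ring.
by rewrite !half; exact: regroup.
Qed.

(** The second derivatives of g_{cd} along a and b cancel. Exchanging the pairs (a, b) and (c, d)
    permutes the other four second derivatives, once partial derivatives commute, and preserves each
    pairing term. *)
Lemma riem_pair_sym x a b c d : U x ->
  riem g x (ebase a) (ebase b) (ebase c) (ebase d) =
  riem g x (ebase c) (ebase d) (ebase a) (ebase b).
Proof.
have regroup (X1 X2 X3 X4 X5 X6 P1 P2 : R) :
    2^-1 * (X1 + X2 - X3) - 2^-1 * (X1 + X4 - X5) - P1 + P2 =
    2^-1 * (X6 + X2 - X4) - 2^-1 * (X6 + X3 - X5) - P1 + P2 by ring.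
move=> Ux; rewrite (riem_basis a b c d Ux) (riem_basis c d a b Ux).
rewrite !(partial_christoffel1 _ _ _ _ Ux).
have Pr i j k l : christoffel_pairing i j k l x = christoffel_pairing i j l k x.
  by apply: eq_bigr => m _; rewrite christoffel_sym.
have Pl i j k l : christoffel_pairing i j k l x = christoffel_pairing j i k l x.
  by rewrite christoffel_pairing_sym // Pr christoffel_pairing_sym.
rewrite (christoffel_pairing_sym c b d a Ux).
rewrite (Pr d a) (Pl d a) (Pr d b) (Pl d b).
rewrite (ddmetric_swap b a c d Ux) (ddmetric_swap d c a b Ux).
rewrite (ddmetric_swap c a d b Ux) (ddmetric_sym a c d b Ux).
rewrite (ddmetric_swap c b d a Ux) (ddmetric_sym b c d a Ux).
rewrite (ddmetric_swap d a c b Ux) (ddmetric_sym a d c b Ux).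
rewrite (ddmetric_swap d b c a Ux) (ddmetric_sym b d c a Ux).
exact: regroup.
Qed.

Lemma lam2_riem_sym x : U x -> (lam2_form (riem g x))^T = lam2_form (riem g x).
Proof.
by move=> Ux; apply/matrixP => i j; rewrite !mxE riem_pair_sym.
Qed.

End CurvatureSymmetry.

Theorem proposition4 (R : realType) (M : oriented_manifold4 R)
    (g : riemannian_metric M) (p : M)
    (c : chart R M) (c_atlas : atlas c) (c_p : cdom c p) :
  (exists h : 'M[R]_4, inner_product h /\
     comm_mx (curv_op (gcoef g c) (cmap c p)) (hodge h)) <->
  diagonalizable (curv_op (gcoef g c) (cmap c p)).
Proof.
have Ux := cmap_img c_p; set x := cmap c p in Ux *.
have Rm_sym := lam2_riem_sym (@cimg_open _ _ c) (gcoef_smooth g c_atlas)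
  (gcoef_inner g c_atlas) Ux.
(* Since S squares to 1, both sides are the same multiple of the matrix of the curvature tensor, the
   right one by its pair symmetry. *)
have A_sym : curv_op (gcoef g c) x *m lam2_form (@vol4 R) =
    lam2_form (@vol4 R) *m (curv_op (gcoef g c) x)^T.
  have d0 : (dvol (gcoef g c x))^-1 != 0.
    by rewrite invr_eq0 gt_eqF // dvol_gt0 //; exact: gcoef_inner.
  rewrite /curv_op /wedge_pairing invmxZ ?unitmxZ ?unitfE ?vol4_unit //.
  rewrite invmx_vol4 -scalemxAr linearZ /= -scalemxAl -scalemxAr.
  congr (_ *: _).
  rewrite trmx_mul Rm_sym vol4_gram_sym mulmxA vol4_gramV mul1mx.
  by rewrite -mulmxA vol4_gramV mulmx1.
split; last exact: diagonalizable_comm_hodge.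
by case=> h [h_inner]; exact: comm_hodge_diagonalizable.
Qed.
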